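(* Let $\mathcal{M}$ be a multicategory. The rewrite relation $\to$ on the terms $T(\mathcal{M})$ is confluent: whenever $t \stackrel{*}{\to} t_1$ and $t \stackrel{*}{\to} t_2$ there is a term $h$ with $t_1 \stackrel{*}{\to} h$ and $t_2 \stackrel{*}{\to} h$.
   Context: **Multicategory notation.** Fix a multicategory $\mathcal{M}$ with set of objects $\mathcal{M}_0$. Morphisms are written in sequent notation: $x_1{:}A_1,\ldots,x_n{:}A_n \vdash v : A$ ($n \ge 0$, distinct variables) denotes a morphism $v \in \mathcal{M}(A_1,\ldots,A_n;A)$; $x{:}A \vdash x : A$ denotes the identity, and for $\Gamma_i \vdash v_i : A_i$ the substitution $v[v_1,\ldots,v_n/x_1,\ldots,x_n]$ denotes the composite $v \circ (v_1,\ldots,v_n)$; expressions denoting the same morphism of $\mathcal{M}$ are identified. Contexts $\Gamma$ are ordered lists of typed variables without repeated variables. $\mathcal{M}_0^{\circ\bullet} = (\mathcal{M}_0 \times \{\circ,\bullet\})^*$ is the free monoid on polarised objects $A^\circ, A^\bullet$, with empty word $\lambda$ (also written $I$). **Terms.** $T(\mathcal{M})$ consists of the terms $t$ with $\Gamma \Vdash t : (U,B,W)$ (where $U,W \in \mathcal{M}_0^{\circ\bullet}$, $B \in \mathcal{M}_0$) derivable by the following rules (bound variables may be renamed): - (seq) if $\Gamma \vdash v : A$ then $\Gamma \Vdash [v] : (\lambda,A,\lambda)$; - (let) if $n \ge 1$, $\Gamma_i \Vdash t_i : (U_{i-1},A_i,U_i)$ for $1 \le i \le n$, and $x_1{:}A_1,\ldots,x_n{:}A_n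 \Vdash t : (V,B,W)$, then $\Gamma_1,\ldots,\Gamma_n \Vdash \mathsf{let}\ x_1,\ldots,x_n \downarrow (t_1 \mid \cdots \mid t_n)\ \mathsf{in}\ t : (U_0V,B,U_nW)$; - (putR) if $\Delta \Vdash t : (U,B,W)$ and $\Gamma \vdash v : A$ then $\Delta,\Gamma \Vdash \mathsf{putR}(v,t) : (U,B,A^\circ W)$; - (getL) if $x{:}A,\Gamma \Vdash t : (U,B,W)$ then $\Gamma \Vdash \mathsf{getL}(x.t) : (A^\circ U,B,W)$; - (getR) if $\Gamma,x{:}A \Vdash t : (U,B,W)$ then $\Gamma \Vdash \mathsf{getR}(x.t) : (U,B,A^\bullet W)$; - (putL) if $\Gamma \vdash v : A$ and $\Delta \Vdash t : (U,B,W)$ then $\Gamma,\Delta \Vdash \mathsf{putL}(v,t) : (A^\bullet U,B,W)$. **Value substitution.** For $\Gamma_i \vdash v_i : A_i$ ($1\le i\le n$) and $x_1{:}A_1,\ldots,x_n{:}A_n \Vdash t : (U,B,W)$, the term $\Gamma_1,\ldots,\Gamma_n \Vdash t[\overline v/\overline x] : (U,B,W)$ is defined by recursion: $[u][\overline v/\overline x] = [u[\overline v/\overline x]]$; $\mathsf{putR}(u,s)[\overline v/\overline x] = \mathsf{putR}(u[\overline{v_2}/\overline{x_2}],s[\overline{v_1}/\overline{x_1}])$ and $\mathsf{putL}(u,s)[\overline v/\overline x] = \mathsf{putL}(u[\overline{v_1}/\overline{x_1}],s[\overline{v_2}/\overline{x_2}])$, where $\overline x = \overline{x_1},\overline{x_2}$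 is split as dictated by the typing rule (and $\overline v$ accordingly); $\mathsf{getL}(y.s)[\overline v/\overline x] = \mathsf{getL}(y.s[\overline v/\overline x])$ and $\mathsf{getR}(y.s)[\overline v/\overline x] = \mathsf{getR}(y.s[\overline v/\overline x])$ ($y$ being substituted for itself); $(\mathsf{let}\ \overline y \downarrow (t_1 \mid \cdots \mid t_m)\ \mathsf{in}\ s)[\overline v/\overline x] = \mathsf{let}\ \overline y \downarrow (t_1[\overline{v_1}/\overline{x_1}] \mid \cdots \mid t_m[\overline{v_m}/\overline{x_m}])\ \mathsf{in}\ s$ with $\overline x$ split into the contexts $\overline{x_j}$ of the $t_j$. Variables substituted for themselves may be omitted, as in $t[v/y]$. **Rewriting.** $\to$ is the least relation on terms closed under all term formers (i.e. under rewriting subterms) containing (where $\overline a,\overline b$ are possibly empty sequences of terms): - [R0] $\mathsf{let}\ x_1,\ldots,x_n \downarrow ([v_1] \mid \cdots \mid [v_n])\ \mathsf{in}\ t \to t[v_1,\ldots,v_n/x_1,\ldots,x_n]$ - [R1] $\mathsf{let}\ \overline x \downarrow (\overline a \mid \mathsf{putR}(v,t) \mid \mathsf{getL}(y.s) \mid \overline b)\ \mathsf{in}\ r \to \mathsf{let}\ \overline x \downarrow (\overline a \mid t \mid s[v/y] \mid \overline b)\ \mathsf{in}\ r$ - [R2] $\mathsf{let}\ \overline x \downarrow (\overline a \mid \mathsf{getR}(y.t) \mid \mathsf{putL}(v,s) \mid \overline b)\ \mathsf{in}\ r \to \mathsf{let}\ \overline x \downarrow (\overline a \mid t[v/y] \mid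 s \mid \overline b)\ \mathsf{in}\ r$ - [R3] $\mathsf{let}\ \overline x \downarrow (\mathsf{putL}(v,t) \mid \overline a)\ \mathsf{in}\ r \to \mathsf{putL}(v,\mathsf{let}\ \overline x \downarrow (t \mid \overline a)\ \mathsf{in}\ r)$ - [R4] $\mathsf{let}\ \overline x \downarrow (\mathsf{getL}(y.t) \mid \overline a)\ \mathsf{in}\ r \to \mathsf{getL}(y.\mathsf{let}\ \overline x \downarrow (t \mid \overline a)\ \mathsf{in}\ r)$ - [R5] $\mathsf{let}\ \overline x \downarrow (\overline a \mid \mathsf{putR}(v,t))\ \mathsf{in}\ r \to \mathsf{putR}(v,\mathsf{let}\ \overline x \downarrow (\overline a \mid t)\ \mathsf{in}\ r)$ - [R6] $\mathsf{let}\ \overline x \downarrow (\overline a \mid \mathsf{getR}(y.t))\ \mathsf{in}\ r \to \mathsf{getR}(y.\mathsf{let}\ \overline x \downarrow (\overline a \mid t)\ \mathsf{in}\ r)$ - [R7] $\mathsf{putR}(v,\mathsf{putL}(w,t)) \to \mathsf{putL}(w,\mathsf{putR}(v,t))$ - [R8] $\mathsf{putR}(v,\mathsf{getL}(x.t)) \to \mathsf{getL}(x.\mathsf{putR}(v,t))$ when $x$ does not occur in $v$ - [R9] $\mathsf{getR}(x.\mathsf{putL}(v,t)) \to \mathsf{putL}(v,\mathsf{getR}(x.t))$ when $x$ does not occur in $v$ - [R10] $\mathsf{getR}(x.\mathsf{getL}(y.t)) \to \mathsf{getL}(y.\mathsf{getR}(x.t))$ $\stackrel{*}{\to}$ denotes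 the reflexive transitive closure of $\to$. *)

(* Defs.v *)
From Stdlib Require Import Relation_Operators.
From mathcomp Require Import all_boot.

Set Implicit Arguments.
Unset Strict Implicit.
Unset Printing Implicit Defensive.

(** Multicategories, presented by one type of morphisms with source and target:
    the hom-set M(A_1, ..., A_n; A) consists of the [v] with
    [dom v = [:: A_1; ...; A_n]] and [cod v = A].  The composite
    [comp v [:: v_1; ...; v_n]] is v o (v_1, ..., v_n); it is a total function
    whose value is unconstrained unless the targets of the v_i form the source
    of v, that is unless [map cod vs = dom v]. *)
Record multicategory : Type := Multicategory {
  obj : Type;
  mor : Type;
  dom : mor -> seq obj;
  cod : mor -> obj;
  idm : obj -> mor;
  comp : mor -> seq mor -> mor;
  dom_idm : forall A, dom (idm A) = [:: A];
  cod_idm : forall A, cod (idm A) = A;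
  dom_comp : forall v vs, map cod vs = dom v ->
    dom (comp v vs) = flatten (map dom vs);
  cod_comp : forall v vs, map cod vs = dom v -> cod (comp v vs) = cod v;
  comp_idl : forall v, comp (idm (cod v)) [:: v] = v;
  comp_idr : forall v, comp v (map idm (dom v)) = v;
  comp_assoc : forall v vs wss,
    map cod vs = dom v -> map (map cod) wss = map dom vs ->
    comp (comp v vs) (flatten wss)
      = comp v [seq comp p.1 p.2 | p <- zip vs wss]
}.

Arguments idm {m} A.
Arguments comp {m} v vs.

Inductive polarity : Type := White | Black.

Definition word (M : multicategory) : Type := seq (obj M * polarity).

(** Since contexts are ordered and every variable is used exactly once, in
    order, variables are left nameless: a context is the list of the types of
    its variables, a value x_1 : A_1, ..., x_n : A_n |- v : A is a morphism of
    the multicategory, and renaming of variables becomes equality.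
    The variable bound by [GetL A t] (resp. [GetR A t]), of type [A], is the
    first (resp. last) variable of the context of [t]; the variables bound by
    [Let ts t] form the whole context of [t]. *)
Inductive preterm (M : multicategory) : Type :=
| Ret of mor M
| Let of seq (preterm M) & preterm M
| PutR of mor M & preterm M
| GetL of obj M & preterm M
| GetR of obj M & preterm M
| PutL of mor M & preterm M.

Arguments Ret {M} v.
Arguments Let {M} ts t.
Arguments PutR {M} v t.
Arguments GetL {M} A t.
Arguments GetR {M} A t.
Arguments PutL {M} v t.

(** [has_type G t U B W] is the judgement G ||- t : (U, B, W), and
    [has_types G [:: t_1; ...; t_n] U_0 [:: A_1; ...; A_n] U_n] states that
    G = G_1, ..., G_n with G_i ||- t_i : (U_{i-1}, A_i, U_i) for some words
    U_1, ..., U_{n-1}. *)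
Inductive has_type (M : multicategory) :
    seq (obj M) -> preterm M -> word M -> obj M -> word M -> Prop :=
| type_ret v :
    has_type (dom v) (Ret v) [::] (cod v) [::]
| type_let G ts U0 As Un t V B W :
    0 < size ts -> has_types G ts U0 As Un -> has_type As t V B W ->
    has_type G (Let ts t) (U0 ++ V) B (Un ++ W)
| type_putR v D t U B W :
    has_type D t U B W ->
    has_type (D ++ dom v) (PutR v t) U B ((cod v, White) :: W)
| type_getL A G t U B W :
    has_type (A :: G) t U B W ->
    has_type G (GetL A t) ((A, White) :: U) B W
| type_getR A G t U B W :
    has_type (rcons G A) t U B W ->
    has_type G (GetR A t) U B ((A, Black) :: W)
| type_putL v D t U B W :
    has_type D t U B W ->
    has_type (dom v ++ D) (PutL v t) ((cod v, Black) :: U) B W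
with has_types (M : multicategory) :
    seq (obj M) -> seq (preterm M) -> word M -> seq (obj M) -> word M -> Prop :=
| types_nil U :
    has_types [::] [::] U [::] U
| types_cons G D t ts U A V As W :
    has_type G t U A V -> has_types D ts V As W ->
    has_types (G ++ D) (t :: ts) U (A :: As) W.

(** The context of a term: [has_type G t U B W] implies [G = ctx t]. *)
Fixpoint ctx (M : multicategory) (t : preterm M) : seq (obj M) :=
  match t with
  | Ret v => dom v
  | Let ts _ => flatten (map (@ctx M) ts)
  | PutR v s => ctx s ++ dom v
  | GetL _ s => behead (ctx s)
  | GetR _ s => take (size (ctx s)).-1 (ctx s)
  | PutL v s => dom v ++ ctx s
  end.

(** [vsubst t vs] is t[v_1, ..., v_n / x_1, ..., x_n], where x_1, ..., x_n are
    all the variables of the context of [t]. *)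
Fixpoint vsubst (M : multicategory) (t : preterm M) (vs : seq (mor M)) :
    preterm M :=
  match t with
  | Ret u => Ret (comp u vs)
  | Let ts s =>
      Let ((fix vsubsts (ts : seq (preterm M)) (vs : seq (mor M)) :=
              match ts with
              | [::] => [::]
              | t1 :: ts1 =>
                  vsubst t1 (take (size (ctx t1)) vs)
                    :: vsubsts ts1 (drop (size (ctx t1)) vs)
              end) ts vs) s
  | PutR u s =>
      PutR (comp u (drop (size (ctx s)) vs)) (vsubst s (take (size (ctx s)) vs))
  | GetL A s => GetL A (vsubst s (idm A :: vs))
  | GetR A s => GetR A (vsubst s (rcons vs (idm A)))
  | PutL u s =>
      PutL (comp u (take (size (dom u)) vs)) (vsubst s (drop (size (dom u)) vs))
  end.

(** t[v/y], for y the first (resp. last) variable of the context of [t], the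
    other variables being substituted for themselves. *)
Definition vsubst_first (M : multicategory) (v : mor M) (t : preterm M) :=
  vsubst t (v :: map idm (behead (ctx t))).

Definition vsubst_last (M : multicategory) (v : mor M) (t : preterm M) :=
  vsubst t (rcons (map idm (take (size (ctx t)).-1 (ctx t))) v).

(** The side condition "x does not occur in v" of [R8] always holds for
    nameless terms, as [v] is outside the scope of the binder of x.  In [R9],
    x is the last variable of the context [dom v ++ ctx t], so that it does not
    occur in [v] exactly when [ctx t] is nonempty. *)
Inductive prestep (M : multicategory) : preterm M -> preterm M -> Prop :=
| R0 vs t :
    prestep (Let (map Ret vs) t) (vsubst t vs)
| R1 a b v A t s r :
    prestep (Let (a ++ [:: PutR v t, GetL A s & b]) r)
            (Let (a ++ [:: t, vsubst_first v s & b]) r)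
| R2 a b v A t s r :
    prestep (Let (a ++ [:: GetR A t, PutL v s & b]) r)
            (Let (a ++ [:: vsubst_last v t, s & b]) r)
| R3 a v t r :
    prestep (Let (PutL v t :: a) r) (PutL v (Let (t :: a) r))
| R4 a A t r :
    prestep (Let (GetL A t :: a) r) (GetL A (Let (t :: a) r))
| R5 a v t r :
    prestep (Let (rcons a (PutR v t)) r) (PutR v (Let (rcons a t) r))
| R6 a A t r :
    prestep (Let (rcons a (GetR A t)) r) (GetR A (Let (rcons a t) r))
| R7 v w t :
    prestep (PutR v (PutL w t)) (PutL w (PutR v t))
| R8 v A t :
    prestep (PutR v (GetL A t)) (GetL A (PutR v t))
| R9 v A t :
    0 < size (ctx t) ->
    prestep (GetR A (PutL v t)) (PutL v (GetR A t))
| R10 A B t :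
    prestep (GetR A (GetL B t)) (GetL B (GetR A t))
| step_let_arg a b t t' r :
    prestep t t' -> prestep (Let (a ++ t :: b) r) (Let (a ++ t' :: b) r)
| step_let_body ts r r' :
    prestep r r' -> prestep (Let ts r) (Let ts r')
| step_putR v t t' :
    prestep t t' -> prestep (PutR v t) (PutR v t')
| step_getL A t t' :
    prestep t t' -> prestep (GetL A t) (GetL A t')
| step_getR A t t' :
    prestep t t' -> prestep (GetR A t) (GetR A t')
| step_putL v t t' :
    prestep t t' -> prestep (PutL v t) (PutL v t').

(** The set T(M) of terms, and the rewrite relations on it.  The rules preserve
    the typing judgement and all subterms of a term are terms, so restricting
    [prestep] to terms adds no condition on the intermediate redexes. *)
Definition term (M : multicategory) : Type :=
  {t : preterm M | exists G U B W, has_type G t U B W}.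

Definition step (M : multicategory) (t t' : term M) : Prop :=
  prestep (sval t) (sval t').

Definition steps (M : multicategory) : term M -> term M -> Prop :=
  clos_refl_trans (term M) (@step M).

(* Main.v *)
(** The idea is to evaluate every typed term to a normal form [nf t] which is
    invariant under rewriting and to which [t] rewrites; two reducts of [t] then
    both reach the normal form of [t].  Neither termination nor an analysis of
    critical pairs is needed.

    A let-free term is a sequence of operations on its left boundary (putL, getL)
    and its right boundary (putR, getR), ended by a value.  Parallel terms
    t_1 | ... | t_n evaluate to one such sequence, now ended by n values: the
    operations on the boundary between t_i and t_(i+1) cancel by [R1] and [R2],
    those on the outer boundaries are emitted, left ones first, and each right one
    is then moved below as many left ones as [R7]-[R10] allow.  Invariance under
    [R7]-[R10] in an argument of a let amounts to the fact that delaying a right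
    operation commutes with this evaluation. *)

From Stdlib Require Import Relation_Operators Operators_Properties ProofIrrelevance.
From mathcomp Require Import all_boot zify.
Require Import Defs.

Set Implicit Arguments.
Unset Strict Implicit.
Unset Printing Implicit Defensive.

(** * Composition of lists of values *)

Section Substitutions.

Variable M : multicategory.
Implicit Types (u v w : mor M) (vs ws s : seq (mor M)) (A B : obj M).
Implicit Types (G D E As Bs : seq (obj M)).

Definition src vs := flatten (map (@dom M) vs).
Definition tgt vs := map (@cod M) vs.

(** A list [vs] is a morphism from [src vs] to [tgt vs] in the free strict monoidal category on the
    multicategory; [comps] is composition there, and the lists [map idm G] are its identities. *)
Fixpoint comps vs s :=
  if vs is v :: vs' then
    comp v (take (size (dom v)) s) :: comps vs' (drop (size (dom v)) s)
  else [::].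

Lemma tgt_cat vs ws : tgt (vs ++ ws) = tgt vs ++ tgt ws.
Proof. exact: map_cat. Qed.

Lemma src_cat vs ws : src (vs ++ ws) = src vs ++ src ws.
Proof. by rewrite /src map_cat flatten_cat. Qed.

Lemma size_tgt vs : size (tgt vs) = size vs.
Proof. exact: size_map. Qed.

Lemma tgt_idm G : tgt (map idm G) = G.
Proof. by elim: G => //= A G ->; rewrite cod_idm. Qed.

Lemma src_idm G : src (map idm G) = G.
Proof. by elim: G => //= A G; rewrite /src /= dom_idm => ->. Qed.

Lemma tgt_split s D E : tgt s = D ++ E ->
  exists s1 s2, [/\ s = s1 ++ s2, tgt s1 = D & tgt s2 = E].
Proof.
move=> h; exists (take (size D) s), (drop (size D) s).
by rewrite cat_take_drop /tgt map_take map_drop -/(tgt s) h take_size_cat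
  ?drop_size_cat.
Qed.

Lemma tgt_size s G : tgt s = G -> size s = size G.
Proof. by move=> <-; rewrite size_tgt. Qed.

Lemma comps_cat vs ws s1 s2 : size s1 = size (src vs) ->
  comps (vs ++ ws) (s1 ++ s2) = comps vs s1 ++ comps ws s2.
Proof.
elim: vs s1 => [|v vs IH] s1; first by move/size0nil->.
rewrite /src /= size_cat => h.
rewrite takel_cat ?h ?leq_addr // drop_cat.
case: ltnP => h1.
  by rewrite IH // size_drop h addKn.
have e : size s1 = size (dom v) by apply/eqP; rewrite eqn_leq h1 h leq_addr.
rewrite e subnn drop0 drop_oversize ?e // -[s2 in LHS]cat0s IH //.
by move: h; rewrite e /src /=; lia.
Qed.

Lemma comps1 v s : tgt s = dom v -> comps [:: v] s = [:: comp v s].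
Proof. by move=> /tgt_size /= <-; rewrite take_size. Qed.

Lemma tgt_comps vs s : tgt s = src vs -> tgt (comps vs s) = tgt vs.
Proof.
elim: vs s => [|v vs IH] s //= /tgt_split [s1 [s2 [-> h1 h2]]].
rewrite take_size_cat ?drop_size_cat ?(tgt_size h1) // IH //.
by rewrite cod_comp.
Qed.

Lemma src_comps vs s : tgt s = src vs -> src (comps vs s) = src s.
Proof.
elim: vs s => [|v vs IH] s /=; first by move/tgt_size/size0nil->.
move=> /tgt_split [s1 [s2 [-> h1 h2]]].
rewrite take_size_cat ?drop_size_cat ?(tgt_size h1) // src_cat -(IH s2) //.
by rewrite /src /= dom_comp.
Qed.

Lemma comps_idl s : comps (map idm (tgt s)) s = s.
Proof. by elim: s => //= v s IH; rewrite dom_idm /= take0 drop0 IH comp_idl. Qed.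

Lemma comps_idr vs : comps vs (map idm (src vs)) = vs.
Proof.
elim: vs => //= v vs IH; rewrite /src /= map_cat.
by rewrite take_size_cat ?drop_size_cat ?size_map // comp_idr IH.
Qed.

Lemma comp_comps v s r : tgt s = dom v -> tgt r = src s ->
  comp (comp v s) r = comp v (comps s r).
Proof.
(* Associativity expects a nested list, so [r] is cut into blocks of the lengths of the sources of
   [s]. *)
move=> hs hr; pose wss := reshape (map (fun w => size (dom w)) s) r.
have hwss : flatten wss = r.
  rewrite reshapeKr // (tgt_size hr) /src size_flatten /shape -map_comp.
  by rewrite eq_leq.
have h2 : map (@tgt) wss = map (@dom M) s.
  rewrite /wss; elim: s r hr {hs wss hwss} => //= w s IH r /tgt_split.
  case=> r1 [r2 [-> h1 h2]].
  by rewrite take_size_cat ?drop_size_cat ?(tgt_size h1) // h1 IH.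
rewrite -{1}hwss comp_assoc //; congr (comp v _); rewrite /wss.
elim: s r {hs hr wss hwss h2} => //= w s IH r; congr (_ :: _); exact: IH.
Qed.

Lemma comps_comps vs s r : tgt s = src vs -> tgt r = src s ->
  comps (comps vs s) r = comps vs (comps s r).
Proof.
elim: vs s r => [|v vs IH] s r //= /tgt_split [s1 [s2 [-> h1 h2]]].
rewrite src_cat => /tgt_split [r1 [r2 [-> k1 k2]]].
rewrite comps_cat ?(tgt_size k1) //.
have c1 := tgt_size h1; have d1 : size (comps s1 r1) = size (dom v).
  by rewrite -size_tgt tgt_comps // size_tgt.
have e : size (dom (comp v s1)) = size r1 by rewrite dom_comp // (tgt_size k1).
rewrite !take_size_cat ?drop_size_cat // comp_comps //.
by rewrite IH.
Qed.

Lemma tgt_rcons s v : tgt (rcons s v) = rcons (tgt s) (cod v).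
Proof. exact: map_rcons. Qed.

Lemma src_rcons s v : src (rcons s v) = src s ++ dom v.
Proof. by rewrite -cats1 src_cat /src /= cats0. Qed.

End Substitutions.

(** * Traces *)

Section Traces.

Variable M : multicategory.
Implicit Types (u v w : mor M) (vs ws s r : seq (mor M)) (A B : obj M).
Implicit Types (G D E C As Bs : seq (obj M)) (U V W : word M).

Inductive op : Type := Put of mor M | Get of obj M.

(** Unlike a let-free term, a trace may end with several values: those of the
    arguments of a let, before they are substituted in its body. *)
Inductive trace : Type :=
| End of seq (mor M)
| OpL of op & trace
| OpR of op & trace.

Implicit Types (o l : op) (N P Q X : trace).

(** [G] is the context of a trace headed by [o], and [D] that of its tail. A relation suits both
    kinds of operation: a put determines [G] from [D], a get determines [D] from [G]. *)
Definition actL o G D :=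
  match o with Put v => G = dom v ++ D | Get A => D = A :: G end.

Definition actR o G D :=
  match o with Put v => G = D ++ dom v | Get A => D = rcons G A end.

Definition lword o :=
  match o with Put v => (cod v, Black) | Get A => (A, White) end.

Definition rword o :=
  match o with Put v => (cod v, White) | Get A => (A, Black) end.

Fixpoint wt N G U As W : Prop :=
  match N with
  | End vs => [/\ G = src vs, U = [::], As = tgt vs & W = [::]]
  | OpL o N' => exists D U', [/\ actL o G D, U = lword o :: U' & wt N' D U' As W]
  | OpR o N' => exists D W', [/\ actR o G D, W = rword o :: W' & wt N' D U As W']
  end.

Fixpoint tctx N :=
  match N with
  | End vs => src vs
  | OpL (Put v) N' => dom v ++ tctx N'
  | OpL (Get _) N' => behead (tctx N')
  | OpR (Put v) N' => tctx N' ++ dom v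
  | OpR (Get _) N' => take (size (tctx N')).-1 (tctx N')
  end.

Lemma take_rcons_pred (T : Type) (p : seq T) x :
  take (size (rcons p x)).-1 (rcons p x) = p.
Proof. by rewrite size_rcons -cats1 take_size_cat. Qed.

Lemma wt_ctx N G U As W : wt N G U As W -> tctx N = G.
Proof.
elim: N G U As W => [vs|[v|A] N IH|[v|A] N IH] G U As W /=; first by case.
- by case=> [D [U' [-> _ /IH ->]]].
- by case=> [D [U' [-> _ /IH ->]]].
- by case=> [D [U' [-> _ /IH ->]]].
by case=> [D [U' [-> _ /IH ->]]]; rewrite take_rcons_pred.
Qed.

(** * Substitution of values in traces *)

Definition op_subL o s :=
  match o with Put v => Put (comp v (take (size (dom v)) s)) | Get A => Get A end.

Definition sub_belowL o s :=
  match o with Put v => drop (size (dom v)) s | Get A => idm A :: s end.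

(** [n] is the size of the context below [o]: the variables of a putR come last, so those kept for
    the tail have to be counted. *)
Definition op_subR n o s :=
  match o with Put v => Put (comp v (drop n s)) | Get A => Get A end.

Definition sub_belowR n o s :=
  match o with Put v => take n s | Get A => rcons s (idm A) end.

Fixpoint tsub N s :=
  match N with
  | End vs => End (comps vs s)
  | OpL o N' => OpL (op_subL o s) (tsub N' (sub_belowL o s))
  | OpR o N' => OpR (op_subR (size (tctx N')) o s)
                    (tsub N' (sub_belowR (size (tctx N')) o s))
  end.

Lemma subL_spec o G D s : actL o G D -> tgt s = G ->
  [/\ tgt (sub_belowL o s) = D, actL (op_subL o s) (src s) (src (sub_belowL o s))
    & lword (op_subL o s) = lword o].
Proof.
case: o => [v|A] /= ->; last by move=> <-; rewrite cod_idm /src /= dom_idm.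
move=> /tgt_split [s1 [s2 [-> h1 h2]]].
rewrite take_size_cat ?drop_size_cat ?(tgt_size h1) // src_cat.
by rewrite dom_comp ?cod_comp.
Qed.

Lemma subR_spec o G D s : actR o G D -> tgt s = G ->
  [/\ tgt (sub_belowR (size D) o s) = D,
      actR (op_subR (size D) o s) (src s) (src (sub_belowR (size D) o s))
    & rword (op_subR (size D) o s) = rword o].
Proof.
case: o => [v|A] /= ->; last first.
  by move=> <-; rewrite tgt_rcons cod_idm src_rcons dom_idm cats1.
move=> /tgt_split [s1 [s2 [-> h1 h2]]].
rewrite take_size_cat ?drop_size_cat ?(tgt_size h1) // src_cat.
by rewrite dom_comp ?cod_comp.
Qed.

Lemma wt_tsub N G U As W s : wt N G U As W -> tgt s = G ->
  wt (tsub N s) (src s) U As W.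
Proof.
elim: N G U As W s => [vs|o N IH|o N IH] G U As W s /=.
- by case=> -> -> -> -> h; rewrite tgt_comps ?src_comps.
- case=> D [U' [a -> h]] hs; have [h1 h2 h3] := subL_spec a hs.
  by exists (src (sub_belowL o s)), U'; rewrite h3; split=> //; apply: IH h h1.
case=> D [U' [a -> h]] hs; have [h1 h2 h3] := subR_spec a hs.
rewrite (wt_ctx h).
by exists (src (sub_belowR (size D) o s)), U'; rewrite h3; split=> //; apply: IH h h1.
Qed.

Lemma tctx_tsub N G U As W s : wt N G U As W -> tgt s = G ->
  tctx (tsub N s) = src s.
Proof. by move=> h hs; exact: wt_ctx (wt_tsub h hs). Qed.

Lemma tsub_id N G U As W : wt N G U As W -> tsub N (map idm G) = N.
Proof.
elim: N G U As W => [vs|o N IH|o N IH] G U As W /=.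
- by case=> -> _ _ _; rewrite comps_idr.
- case=> D [U' [a _ h]]; case: o a => [v|A] /= e.
    rewrite e map_cat take_size_cat ?drop_size_cat ?size_map //.
    by rewrite comp_idr (IH _ _ _ _ h).
  by rewrite -map_cons -e (IH _ _ _ _ h).
case=> D [U' [a _ h]]; rewrite (wt_ctx h); case: o a => [v|A] /= e.
  rewrite e map_cat take_size_cat ?drop_size_cat ?size_map //.
  by rewrite comp_idr (IH _ _ _ _ h).
by rewrite -map_rcons -e (IH _ _ _ _ h).
Qed.

Lemma op_subL_comps o G D s r : actL o G D -> tgt s = G -> tgt r = src s ->
  op_subL (op_subL o s) r = op_subL o (comps s r) /\
  comps (sub_belowL o s) (sub_belowL (op_subL o s) r) = sub_belowL o (comps s r).
Proof.
case: o => [v|A] /=; last first.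
  move=> _ _ _; rewrite dom_idm /= take0 drop0; split=> //.
  by rewrite -[in comp (idm A)](cod_idm A) comp_idl.
move=> -> /tgt_split [s1 [s2 [-> h1 h2]]].
rewrite src_cat => /tgt_split [r1 [r2 [-> k1 k2]]].
rewrite !(take_size_cat, drop_size_cat) ?dom_comp ?(tgt_size h1)
  -?/(src s1) ?(tgt_size k1) //.
rewrite comps_cat ?(tgt_size k1) //.
have e : size (comps s1 r1) = size (dom v) by rewrite -size_tgt tgt_comps ?h1.
by rewrite take_size_cat ?drop_size_cat // comp_comps.
Qed.

Lemma op_subR_comps o G D s r : actR o G D -> tgt s = G -> tgt r = src s ->
  let n := size (src (sub_belowR (size D) o s)) in
  op_subR n (op_subR (size D) o s) r = op_subR (size D) o (comps s r) /\
  comps (sub_belowR (size D) o s) (sub_belowR n (op_subR (size D) o s) r)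
    = sub_belowR (size D) o (comps s r).
Proof.
case: o => [v|A] /=; last first.
  move=> _ _ hr; split=> //; rewrite -!cats1 comps_cat ?(tgt_size hr) //=.
  by rewrite dom_idm /= -[in comp (idm A)](cod_idm A) comp_idl.
move=> -> /tgt_split [s1 [s2 [-> h1 h2]]].
rewrite src_cat => /tgt_split [r1 [r2 [-> k1 k2]]].
rewrite !(take_size_cat, drop_size_cat) ?(tgt_size h1) ?(tgt_size k1) //.
rewrite comps_cat ?(tgt_size k1) //.
have e : size (comps s1 r1) = size D by rewrite -size_tgt tgt_comps ?h1.
by rewrite !(take_size_cat, drop_size_cat) ?(tgt_size h1) ?(tgt_size k1) // comp_comps.
Qed.

Lemma tsub_tsub N G U As W s r : wt N G U As W -> tgt s = G -> tgt r = src s ->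
  tsub (tsub N s) r = tsub N (comps s r).
Proof.
elim: N G U As W s r => [vs|o N IH|o N IH] G U As W s r /=.
- by case=> -> _ _ _ hs hr; rewrite comps_comps.
- case=> D [U' [a _ h]] hs hr; have [h1 h2 _] := subL_spec a hs.
  have [<- <-] := op_subL_comps a hs hr; congr OpL.
  have [h3 _ _] := subL_spec h2 hr.
  exact: IH h h1 h3.
case=> D [U' [a _ h]] hs hr; have [h1 h2 _] := subR_spec a hs.
rewrite (wt_ctx h) (tctx_tsub h h1).
have [<- <-] := op_subR_comps a hs hr; congr OpR.
have [h3 _ _] := subR_spec h2 hr.
exact: IH h h1 h3.
Qed.

(** * Delaying a right operation *)

(** [n] is the size of the context below [l]; it is 0 exactly when the variable
    bound by a getR [o] occurs in the value put by [l]. *)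
Definition movable o l (n : nat) :=
  match o, l with Get _, Put _ => 0 < n | _, _ => true end.

Fixpoint opR o N :=
  match N with
  | OpL l N' => if movable o l (size (tctx N')) then OpL l (opR o N') else OpR o N
  | _ => OpR o N
  end.

(** [D'] is the context between the two operations once they have been exchanged. *)
Lemma swap_acts o l G D E : actR o G D -> actL l D E -> movable o l (size E) ->
  exists2 D', actL l G D' & actR o D' E.
Proof.
case: o l => [v|A] [w|B] /=.
- by move=> -> -> _; exists (E ++ dom v); rewrite // catA.
- by move=> -> -> _; exists (B :: D ++ dom v).
(* [movable] excludes an empty [E], so the variable bound by the getR is the last one of [E] and not
   one of [dom w]. *)
- case/lastP: E => // E C ->; rewrite -rcons_cat => /rcons_inj [-> ->] _.
  by exists E.
by move=> -> -> _; exists (B :: G).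
Qed.

Lemma swap_subs o l G D E s : actR o G D -> actL l D E -> movable o l (size E) ->
    tgt s = G ->
  [/\ op_subL l (sub_belowR (size D) o s) = op_subL l s,
      sub_belowL l (sub_belowR (size D) o s) = sub_belowR (size E) o (sub_belowL l s)
    & op_subR (size D) o s = op_subR (size E) o (sub_belowL l s)].
Proof.
case: o l => [v|A] [w|B] /=.
- move=> -> -> _; rewrite -catA => /tgt_split [s1 [s' [-> h1]]].
  move=> /tgt_split [s2 [s3 [-> h2 h3]]].
  rewrite size_cat -(tgt_size h1) -(tgt_size h2) drop_size_cat // catA.
  rewrite take_size_cat ?drop_size_cat ?size_cat //.
  by rewrite -catA !take_size_cat ?drop_size_cat.
- by move=> -> -> _ hs.
- case/lastP: E => [|E C]; first by move=> _ _.
  move=> ->; rewrite -rcons_cat => /rcons_inj [-> ->] _ hs.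
  have h : size (dom w) <= size s by rewrite (tgt_size hs) size_cat leq_addr.
  by rewrite -cats1 takel_cat // cats1 drop_rcons.
by [].
Qed.

(** Substituted values may have empty sources and shrink the context, but the variable bound by a
    getR is replaced by itself: it stays below [l], or stays in the value put by [l], as before. *)
Lemma movable_sub o l G D E s : actR o G D -> actL l D E -> tgt s = G ->
  movable (op_subR (size D) o s) (op_subL l (sub_belowR (size D) o s))
    (size (src (sub_belowL l (sub_belowR (size D) o s)))) = movable o l (size E).
Proof.
case: o l => [v|A] [w|B] //= ->.
case/lastP: E => [|E C].
  rewrite cats0 => e hs; rewrite drop_oversize // -e !size_rcons.
  by rewrite (tgt_size hs).
rewrite -rcons_cat => /rcons_inj [-> ->] hs.
have h : size (dom w) <= size s by rewrite (tgt_size hs) size_cat leq_addr.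
by rewrite drop_rcons // src_rcons dom_idm size_cat size_rcons addn1.
Qed.

Lemma wt_opR o N G D U As W : actR o G D -> wt N D U As W ->
  wt (opR o N) G U As (rword o :: W).
Proof.
elim: N G D U => [vs|l N IH|l N IH] G D U a h; try by exists D, W.
move: h => /= [E [U' [b -> h]]]; rewrite (wt_ctx h); case: ifP => m; last first.
  by exists D, W; split=> //; exists E, U'.
have [D' b' a'] := swap_acts a b m.
by exists D', U'; split=> //; apply: IH a' h.
Qed.

Lemma tsub_opR o N G D U As W s : actR o G D -> wt N D U As W -> tgt s = G ->
  tsub (opR o N) s
    = opR (op_subR (size D) o s) (tsub N (sub_belowR (size D) o s)).
Proof.
elim: N G D U s => [vs|l N IH|l N IH] G D U s a h hs; try by rewrite /= -(wt_ctx h).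
have eD := wt_ctx h; move: h => /= [E [U' [b _ h]]].
have [h1 _ _] := subR_spec a hs; have [h2 _ _] := subL_spec b h1.
rewrite (wt_ctx h) (tctx_tsub h h2) (movable_sub a b hs).
case: ifP => m; last by rewrite -eD.
have [D' b' a'] := swap_acts a b m; have [-> e ->] := swap_subs a b m hs.
have [h3 _ _] := subL_spec b' hs.
by rewrite /= (IH _ _ _ _ a' h h3) e.
Qed.

(** * Juxtaposition of two traces *)

Definition tsub_first v N := tsub N (v :: map idm (behead (tctx N))).

Definition tsub_last v N :=
  tsub N (rcons (map idm (take (size (tctx N)).-1 (tctx N))) v).

Definition startsL N := if N is OpL _ _ then true else false.

(** The clauses of [juxt] below that do not return junk; the other ones are excluded
    by typing, see [juxt_total]. *)
Inductive juxt_graph : trace -> trace -> trace -> Prop :=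
| juxt_L l N P X :
    juxt_graph N P X -> juxt_graph (OpL l N) P (OpL l X)
| juxt_R o N P X : ~~ startsL N ->
    juxt_graph N P X -> juxt_graph N (OpR o P) (opR o X)
| juxt_putget v A N P X :
    juxt_graph N (tsub_first v P) X -> juxt_graph (OpR (Put v) N) (OpL (Get A) P) X
| juxt_getput A v N P X :
    juxt_graph (tsub_last v N) P X -> juxt_graph (OpR (Get A) N) (OpL (Put v) P) X
| juxt_end vs ws : juxt_graph (End vs) (End ws) (End (vs ++ ws)).

Fixpoint tsize N :=
  match N with End _ => 0 | OpL _ N' | OpR _ N' => (tsize N').+1 end.

(** [n] is fuel: [tsub_last] turns [N'] into a term that is not structurally smaller. *)
Fixpoint juxt_rec n N P :=
  if n is n'.+1 then
    match N, P with
    | OpL l N', _ => OpL l (juxt_rec n' N' P)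
    | _, OpR o P' => opR o (juxt_rec n' N P')
    | OpR (Put v) N', OpL (Get _) P' => juxt_rec n' N' (tsub_first v P')
    | OpR (Get _) N', OpL (Put v) P' => juxt_rec n' (tsub_last v N') P'
    | End vs, End ws => End (vs ++ ws)
    | _, _ => N
    end
  else N.

Definition juxt N P := juxt_rec (tsize N + tsize P).+1 N P.

Lemma tsize_tsub N s : tsize (tsub N s) = tsize N.
Proof. by elim: N s => //= o N IH s; rewrite IH. Qed.

Lemma juxt_graph_rec N P X n : juxt_graph N P X -> tsize N + tsize P < n ->
  juxt_rec n N P = X.
Proof.
move=> h; elim: h n => {N P X} [l N P X _ IH|o N P X nL _ IH|v A N P X _ IH|A v N P X _ IH|vs ws]
  [|n] //=; rewrite ?addSn ?addnS ?ltnS => hn.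
- by rewrite IH.
- by case: N nL IH hn => [vs|//|[v|A] N] _ IH hn; rewrite IH.
- by rewrite IH // tsize_tsub ltnW.
- by rewrite IH // tsize_tsub ltnW.
Qed.

Lemma juxtE N P X : juxt_graph N P X -> juxt N P = X.
Proof. by move=> h; apply: juxt_graph_rec. Qed.

Lemma wt_tsub_first v A N G U As W : wt N (A :: G) U As W -> cod v = A ->
  wt (tsub_first v N) (dom v ++ G) U As W.
Proof.
move=> h e; rewrite /tsub_first (wt_ctx h) /=.
have := wt_tsub (s := v :: map idm G) h; rewrite /src /= -/(src _) src_idm.
by apply; rewrite e tgt_idm.
Qed.

Lemma wt_tsub_last v A N G U As W : wt N (rcons G A) U As W -> cod v = A ->
  wt (tsub_last v N) (G ++ dom v) U As W.
Proof.
move=> h e; rewrite /tsub_last (wt_ctx h) take_rcons_pred.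
have := wt_tsub (s := rcons (map idm G) v) h; rewrite src_rcons src_idm.
by apply; rewrite tgt_rcons tgt_idm e.
Qed.

(** The shared word [V] excludes the missing pairs of heads: an [End] has empty words on both sides,
    and two puts, or two gets, facing each other would give the first letter of [V] both
    polarities. *)
Lemma juxt_total N P G D U V W As Bs : wt N G U As V -> wt P D V Bs W ->
  juxt_graph N P (juxt N P).
Proof.
suff H n : tsize N + tsize P < n -> wt N G U As V -> wt P D V Bs W ->
    juxt_graph N P (juxt_rec n N P) by exact: H.
elim: n N P G D U V W As Bs => // n IH N P G D U V W As Bs.
rewrite ltnS; case: N => [vs|l N|o N].
- case: P => [ws|l P|o P] hn.
  + by move=> _ _; apply: juxt_end.
  + by case=> _ _ _ -> /= [? [? []]].
  move=> hN /= [E [W' [a _ h]]]; apply: juxt_R => //; apply: (IH _ _ _ _ _ _ _ _ _ _ hN h).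
  by move: hn; rewrite /=; lia.
- move=> hn /= [E [U' [a _ h]]] hP; apply: juxt_L; apply: (IH _ _ _ _ _ _ _ _ _ _ h hP).
  by move: hn; rewrite /=; lia.
case: P => [ws|l P|o' P] hn.
- by move=> /= [? [? [_ -> _]]] [].
- move=> /= [E [V' [a -> h]]] [F [V'' [b]]].
  case: o l a b {hn} (hn) => [v|A] [w|B] a b hn /=.
  + by [].
  + case=> e <- k; apply: juxt_putget; move: b k => /= -> k.
    by apply: (IH _ _ _ _ _ _ _ _ _ _ h (wt_tsub_first k e));
    rewrite /tsub_first tsize_tsub; move: hn => /=; lia.
  + case=> e <- k; apply: juxt_getput; move: a h => /= -> h.
    by apply: (IH _ _ _ _ _ _ _ _ _ _ (wt_tsub_last h (esym e)) k);
    rewrite /tsub_last tsize_tsub; move: hn => /=; lia.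
  + by [].
move=> hN /= [E [W' [a _ h]]].
have k : juxt_graph (OpR o N) P (juxt_rec n (OpR o N) P).
  by apply: (IH _ _ _ _ _ _ _ _ _ _ hN h); move: hn; rewrite /=; lia.
by case: o hN k hn => [v|A] hN k hn; apply: juxt_R.
Qed.

Lemma actR_cat o C G D : actR o G D -> actR o (C ++ G) (C ++ D).
Proof. by case: o => [v|A] /= ->; rewrite ?catA ?rcons_cat. Qed.

Lemma wt_juxt_graph N P X G D U V W As Bs : juxt_graph N P X ->
  wt N G U As V -> wt P D V Bs W -> wt X (G ++ D) U (As ++ Bs) W.
Proof.
move=> j; elim: j G D U V W As Bs => {N P X}
  [l N P X _ IH|o N P X _ _ IH|v A N P X _ IH|A v N P X _ IH|vs ws] G D U V W As Bs /=.
- case=> E [U' [a -> h]] k; exists (E ++ D), U'; split=> //; last exact: IH h k.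
  by case: l a => [v|A] /= ->; rewrite -?catA.
- move=> h [E [W' [a -> k]]]; apply: wt_opR (IH _ _ _ _ _ _ _ h k).
  exact: actR_cat a.
- case=> E [V' [-> -> h]] [F [V'' [-> [e e'] k]]]; rewrite -catA.
  by move: k; rewrite -e' => k; apply: IH h (wt_tsub_first k e).
- case=> E [V' [-> -> h]] [F [V'' [-> [e e'] k]]]; rewrite catA.
  by move: k; rewrite -e' => k; apply: IH (wt_tsub_last h _) k.
case=> -> -> -> -> [-> _ -> ->].
by rewrite src_cat tgt_cat.
Qed.

Lemma wt_juxt N P G D U V W As Bs : wt N G U As V -> wt P D V Bs W ->
  wt (juxt N P) (G ++ D) U (As ++ Bs) W.
Proof. by move=> h k; apply: (wt_juxt_graph (juxt_total h k) h k). Qed.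

(** * Juxtaposition commutes with substitution *)

Lemma tsub_first_tsub P A v G U As W s r : wt P (A :: G) U As W -> cod v = A ->
    tgt s = dom v -> tgt r = G ->
  tsub_first (comp v s) (tsub P (idm A :: r)) = tsub (tsub_first v P) (s ++ r).
Proof.
move=> h e hs hr; rewrite /tsub_first (wt_ctx h) /=.
have hA : tgt (idm A :: r) = A :: G by rewrite /= cod_idm hr.
rewrite (tctx_tsub h hA) /src /= dom_idm /= -/(src r).
rewrite (tsub_tsub h) //; last first.
  by rewrite /= tgt_idm cod_comp // e /src /= dom_idm.
rewrite (tsub_tsub h) //; last first.
- by rewrite tgt_cat hs hr /src /= -/(src _) src_idm.
- by rewrite /= e tgt_idm.
rewrite /= dom_idm /= take0 drop0 comps_idr -(tgt_size hs) take_size_cat //.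
rewrite drop_size_cat // -hr comps_idl.
by rewrite -[in comp (idm A)]e -(cod_comp hs) comp_idl.
Qed.

Lemma tsub_last_tsub P A v G U As W s r : wt P (rcons G A) U As W -> cod v = A ->
    tgt s = dom v -> tgt r = G ->
  tsub_last (comp v s) (tsub P (rcons r (idm A))) = tsub (tsub_last v P) (r ++ s).
Proof.
move=> h e hs hr; rewrite /tsub_last (wt_ctx h) take_rcons_pred.
have hA : tgt (rcons r (idm A)) = rcons G A by rewrite tgt_rcons cod_idm hr.
have hB : src (rcons r (idm A)) = rcons (src r) A by rewrite src_rcons dom_idm cats1.
rewrite (tctx_tsub h hA) hB take_rcons_pred.
rewrite (tsub_tsub h) //; last first.
  by rewrite hB tgt_rcons tgt_idm cod_comp // e.
rewrite (tsub_tsub h) //; last first.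
- by rewrite tgt_cat hs hr src_rcons src_idm.
- by rewrite tgt_rcons e tgt_idm.
rewrite -!cats1 comps_cat ?size_map // comps_idr.
rewrite comps_cat ?src_idm ?(tgt_size hr) // -hr comps_idl.
rewrite comps1; last by rewrite /= dom_idm cod_comp ?e.
rewrite comps1 //.
by rewrite -[in comp (idm A)]e -(cod_comp hs) comp_idl.
Qed.

(** Every clause of the graph is stable under substitution: a left operation of [N] only touches
    [s], a right one of [P] only touches [r], and a cancelled put hands its share of the values over
    to the other side. *)
Lemma juxt_graph_tsub N P X G D U V W As Bs s r : juxt_graph N P X ->
    wt N G U As V -> wt P D V Bs W -> tgt s = G -> tgt r = D ->
  juxt_graph (tsub N s) (tsub P r) (tsub X (s ++ r)).
Proof.
move=> j; elim: j G D U V W As Bs s r => {N P X}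
  [l N P X j IH|o N P X nL j IH|v A N P X _ IH|A v N P X _ IH|vs ws] G D U V W As Bs s r.
- case=> E [U' [a _ h]] k hs hr; have [h1 _ _] := subL_spec a hs => /=.
  have -> : op_subL l (s ++ r) = op_subL l s.
    case: l a {h1} => //= v e.
    by rewrite takel_cat // (tgt_size hs) e size_cat leq_addr.
  have -> : sub_belowL l (s ++ r) = sub_belowL l s ++ r.
    case: l a {h1} => //= v e.
    rewrite drop_cat (tgt_size hs) e size_cat; case: ltnP => //.
    (* In this branch [E] is empty: the put consumes all of [s], and nothing of [r]. *)
    rewrite -[X in _ <= X -> _]addn0 leq_add2l leqn0 => /eqP e0.
    rewrite e0 addn0 subnn drop0 drop_oversize //.
    by rewrite (tgt_size hs) e size_cat e0 addn0.
  by apply: juxt_L; apply: IH h k h1 hr.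
- move=> h [E [W' [a _ k]]] hs hr /=; rewrite (wt_ctx k).
  have a' := actR_cat G a.
  have hX := wt_juxt_graph j h k.
  have hsr : tgt (s ++ r) = G ++ D by rewrite tgt_cat hs hr.
  rewrite (tsub_opR a' hX hsr).
  have [h1 _ _] := subR_spec a hr.
  have -> : op_subR (size (G ++ E)) o (s ++ r) = op_subR (size E) o r.
    case: o {a a' h1} => //= v.
    by rewrite size_cat -(tgt_size hs) drop_cat ltnNge leq_addr /= addKn.
  have -> : sub_belowR (size (G ++ E)) o (s ++ r) = s ++ sub_belowR (size E) o r.
    case: o {a a' h1} => //= [v|A]; last by rewrite rcons_cat.
    by rewrite size_cat -(tgt_size hs) take_cat ltnNge leq_addr /= addKn.
  by apply: juxt_R; [case: N nL {j IH h} | apply: IH h k hs h1].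
- case=> E [V' [-> -> h]] [F [V'' [-> [e e'] k]]].
  move=> /tgt_split [s1 [s2 [-> h1 h2]]] hr /=; subst V''.
  rewrite (wt_ctx h) take_size_cat ?drop_size_cat ?(tgt_size h1) // -catA.
  apply: juxt_putget; rewrite (tsub_first_tsub k) //.
  apply: IH h (wt_tsub_first k e) h1 _.
  by rewrite tgt_cat h2 hr.
- case=> E [V' [a -> h]] [F [V'' [-> [e e'] k]]].
  move=> hs /tgt_split [r1 [r2 [-> h1 h2]]] /=; subst V''.
  rewrite take_size_cat ?drop_size_cat ?(tgt_size h1) // catA.
  rewrite /= in a; subst E; apply: juxt_getput; rewrite (tsub_last_tsub h) //.
  apply: IH (wt_tsub_last h (esym e)) k _ h2.
  by rewrite tgt_cat hs h1.
case=> -> _ _ _ [-> _ _ _] hs hr; rewrite /= comps_cat ?(tgt_size hs) //.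
exact: juxt_end.
Qed.

Lemma tsub_juxt N P G D U V W As Bs s r : wt N G U As V -> wt P D V Bs W ->
  tgt s = G -> tgt r = D ->
  tsub (juxt N P) (s ++ r) = juxt (tsub N s) (tsub P r).
Proof.
by move=> h k hs hr; rewrite (juxtE (juxt_graph_tsub (juxt_total h k) h k hs hr)).
Qed.

(** * Juxtaposition commutes with delays *)

Lemma tsub_first_opR o v P B G D U As W : actR o G D -> wt P (B :: D) U As W ->
  cod v = B -> tsub_first v (opR o P) = opR o (tsub_first v P).
Proof.
move=> a h e; have a' : actR o (B :: G) (B :: D) by case: o a => [u|A] /= ->.
have k := wt_opR a' h; rewrite /tsub_first (wt_ctx k) (wt_ctx h) /=.
rewrite (tsub_opR a' h) /= ?tgt_idm ?e //.
case: o a {a' k} => [u|A] /= ->; last by rewrite map_rcons.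
by rewrite map_cat take_size_cat ?drop_size_cat ?size_map // comp_idr.
Qed.

(** By [movable], the last variable belongs to the tail [N], so the operation [l] itself is
    untouched. *)
Lemma tsub_last_OpL l v N A G D U As W : actL l (rcons G A) D ->
    movable (Get A) l (size D) -> wt N D U As W -> cod v = A ->
  tsub_last v (OpL l N) = OpL l (tsub_last v N).
Proof.
move=> a m h e; have k : wt (OpL l N) (rcons G A) (lword l :: U) As W by exists D, U.
rewrite /tsub_last (wt_ctx k) (wt_ctx h) take_rcons_pred.
case: l a m {k} => [w|B] /= e1 m; last first.
  by rewrite e1 -(rcons_cons B) take_rcons_pred.
case/lastP: D e1 m h => // D C; rewrite -rcons_cat => /rcons_inj [-> _] _ h.
rewrite take_rcons_pred map_cat rcons_cat.
by rewrite take_size_cat ?drop_size_cat ?size_map // comp_idr.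
Qed.

(** A right operation of the right argument never meets the inner boundary, so it may be delayed
    before or after the juxtaposition. This yields invariance under [R5] and [R6]. *)
Lemma juxt_graph_opR N P X o G D D' U V W As Bs : juxt_graph N P X ->
    wt N G U As V -> wt P D V Bs W -> actR o D' D ->
  juxt_graph N (opR o P) (opR o X).
Proof.
move=> j; elim: j G D D' U V W As Bs => {N P X}
  [l N P X j IH|o' N P X nL j IH|v A N P X _ IH|A v N P X j IH|vs ws] G D D' U V W As Bs.
- case=> E [U' [a _ h]] k b /=.
  (* A variable bound by [o] lies in the context [D] of the right argument, hence never in a value
     put by the left operation [l] of the left one. *)
  have -> : movable o l (size (tctx X)).
    rewrite (wt_ctx (wt_juxt_graph j h k)).
    by move: b; case: (o) => [v|A] //= ->; case: l a => //= v _; rewrite size_cat size_rcons addnS.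
  by apply: juxt_L; apply: IH h k b.
- by move=> h k a; apply: juxt_R => //; apply: juxt_R.
- case=> E [V' [_ -> h]] [F [V'' [-> [e e'] k]]] a; subst V''.
  have m n : movable o (Get A) n by case: (o).
  rewrite /= m; apply: juxt_putget; rewrite (tsub_first_opR a k e).
  exact: IH h (wt_tsub_first k e) (actR_cat (dom v) a).
- case=> E [V' [eE -> h]] [F [V'' [b [e e'] k]]] a; subst V''.
  rewrite /= in eE; subst E; rewrite /= (wt_ctx k); case: ifP => m.
    have [D'' b' a'] := swap_acts a b m.
    by apply: juxt_getput; apply: IH (wt_tsub_last h (esym e)) k a'.
  (* Here [o] is blocked by the putL, so the right argument starts with [o] itself. *)
  by apply: juxt_R => //; apply: juxt_getput.
by move=> _ _ _; apply: juxt_R => //; apply: juxt_end.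
Qed.

(** Delaying the putR only moves it below left operations of [N], which the juxtaposition emits
    first in any case; it then meets the getL. *)
Lemma juxt_graph_putget N P X v A : juxt_graph N (tsub_first v P) X ->
  juxt_graph (opR (Put v) N) (OpL (Get A) P) X.
Proof.
elim: N X => [vs|l N IH|o N IH] X j; try exact: juxt_putget.
inversion j; subst => //=; apply: juxt_L; exact: IH.
Qed.

(** As for [juxt_graph_putget], except that the getR may be blocked by a putL that uses its
    variable; the cancellation then happens at that point, before the remaining left operations are
    emitted. *)
Lemma juxt_graph_getput N P X v A G U As W : wt N (rcons G A) U As W ->
    cod v = A -> juxt_graph (tsub_last v N) P X ->
  juxt_graph (opR (Get A) N) (OpL (Put v) P) X.
Proof.
elim: N G U X => [vs|l N IH|o N IH] G U X h e; try by move=> j; apply: juxt_getput.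
move: (h) => /= [D [U' [a _ k]]]; rewrite (wt_ctx k); case: ifP => m; last first.
  by move=> j; apply: juxt_getput.
rewrite (tsub_last_OpL a m k e) => j; inversion j; subst => //; apply: juxt_L.
by have [D' _ a'] := swap_acts (G := G) (o := Get (cod v)) erefl a m;
  move: k; rewrite a' => k; apply: IH k _ _.
Qed.

(** * Juxtaposition of a list of traces *)

Fixpoint jfold N Ns := if Ns is P :: Ps then juxt N (jfold P Ps) else N.

(** The fold starts from its last trace and not from [End [::]]: the latter has empty words, so it
    cannot be put next to a trace with pending right operations. *)
Definition jall Ns := if Ns is N :: Ps then jfold N Ps else End [::].

Fixpoint wts Ns G U As W : Prop :=
  if Ns is N :: Ps then
    exists G1 G2 A V As',
      [/\ G = G1 ++ G2, As = A :: As', wt N G1 U [:: A] V & wts Ps G2 V As' W]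
  else [/\ G = [::], As = [::] & U = W].

Lemma wt_jfold N Ns G U As W : wts (N :: Ns) G U As W -> wt (jfold N Ns) G U As W.
Proof.
elim: Ns N G U As => [|P Ps IH] N G U As /=.
  by case=> G1 [G2 [A [V [As' [-> -> h [-> -> <-]]]]]]; rewrite cats0.
case=> G1 [G2 [A [V [As' [-> -> h k]]]]].
by apply: wt_juxt h (IH _ _ _ _ k).
Qed.

Lemma jall_cat a N Ns P Ps : jfold N Ns = jfold P Ps ->
  jall (a ++ N :: Ns) = jall (a ++ P :: Ps).
Proof.
move=> e; case: a => //= Q a; elim: a Q => [|R a IH] Q /=; first by rewrite e.
by rewrite IH.
Qed.

Lemma jfoldL l N Ns : jfold (OpL l N) Ns = OpL l (jfold N Ns).
Proof. by case: Ns. Qed.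

Lemma jfold_tsub_first v P Ps A G D U V W As Bs : wt P (A :: G) U As V ->
    wts Ps D V Bs W -> cod v = A ->
  jfold (tsub_first v P) Ps = tsub_first v (jfold P Ps).
Proof.
case: Ps => //= Q Ps h k e; have k' := wt_jfold k; have hX := wt_juxt h k'.
rewrite {2}/tsub_first (wt_ctx hX) /= map_cat -cat_cons (tsub_juxt h k') /= ?tgt_idm ?e //.
by rewrite (tsub_id k') /tsub_first (wt_ctx h).
Qed.

Lemma wt_jfold_cons P Ps A G D U V W Bs : wt P G U [:: A] V -> wts Ps D V Bs W ->
  wt (jfold P Ps) (G ++ D) U (A :: Bs) W.
Proof. by move=> h k; apply: wt_jfold; exists G, D, A, V, Bs. Qed.

(** The fold is nested to the right, and prefixing by a left operation commutes with it, so the getL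
    still heads the right argument when the putR meets it. *)
Lemma jfold_putget v A B N P Ps G D E U V V' W As Bs :
    wt N G U As V -> wt P (A :: D) V [:: B] V' -> wts Ps E V' Bs W -> cod v = A ->
  jfold (opR (Put v) N) (OpL (Get A) P :: Ps) = jfold N (tsub_first v P :: Ps).
Proof.
move=> h k1 k2 e; have k := wt_jfold_cons k1 k2; rewrite cat_cons in k.
rewrite /= jfoldL (jfold_tsub_first k1 k2 e); apply/juxtE/juxt_graph_putget.
exact: juxt_total h (wt_tsub_first k e).
Qed.

Lemma jfold_getput v A N P Ps G D U V W As Bs :
    wt N (rcons G A) U As V -> wts (P :: Ps) D V Bs W -> cod v = A ->
  jfold (opR (Get A) N) (OpL (Put v) P :: Ps) = jfold (tsub_last v N) (P :: Ps).
Proof.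
move=> h /wt_jfold k e; rewrite /= jfoldL; apply/juxtE/(juxt_graph_getput h e).
exact: juxt_total (wt_tsub_last h e) k.
Qed.

Lemma jfold_opR N Ns P o G D D' U V W As Bs : wts (N :: Ns) G U As V ->
    wt P D V Bs W -> actR o D' D ->
  jfold N (rcons Ns (opR o P)) = opR o (jfold N (rcons Ns P)) /\
  wt (jfold N (rcons Ns P)) (G ++ D) U (As ++ Bs) W.
Proof.
elim: Ns N G U As => [|Q Ns IH] N G U As /=.
  case=> G1 [G2 [A [V' [As' [-> -> h [-> -> <-]]]]]] k a; rewrite cats0.
  split; last exact: wt_juxt h k.
  by apply/juxtE/(juxt_graph_opR (juxt_total h k) h k a).
case=> G1 [G2 [A [V' [As' [-> -> h hs]]]]] k a.
have [-> kX] := IH _ _ _ _ hs k a; rewrite -catA.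
split; last exact: wt_juxt h kX.
exact/juxtE/(juxt_graph_opR (juxt_total h kX) h kX)/actR_cat/a.
Qed.

Lemma jall_opR Ns P o G D D' U V W As Bs : wts Ns G U As V ->
    wt P D V Bs W -> actR o D' D ->
  jall (rcons Ns (opR o P)) = opR o (jall (rcons Ns P)) /\
  wt (jall (rcons Ns P)) (G ++ D) U (As ++ Bs) W.
Proof.
case: Ns => [|N Ns] hs k a; last exact: jfold_opR hs k a.
by case: hs => -> -> ->.
Qed.

(** Evaluates a let from the trace [N] of its arguments and the trace [R] of its body. Right
    operations are re-emitted by [opR] because [R] may bring new left operations below them. *)
Fixpoint fin N R :=
  match N with
  | End vs => tsub R vs
  | OpL l N' => OpL l (fin N' R)
  | OpR o N' => opR o (fin N' R)
  end.

Lemma wt_fin N R G U V U' W As Bs : wt N G U As V -> wt R As U' Bs W ->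
  wt (fin N R) G (U ++ U') Bs (V ++ W).
Proof.
elim: N G U V => [vs|l N IH|o N IH] G U V /=.
- by case=> -> -> e -> h; apply: wt_tsub h _.
- case=> D [V' [a -> h]] k; exists D, (V' ++ U'); split=> //; exact: IH.
by case=> D [V' [a -> h]] k; apply: wt_opR a (IH _ _ _ h k).
Qed.

Lemma fin_opR N R o G D U V U' W As Bs : wt N D U As V -> wt R As U' Bs W ->
  actR o G D -> fin (opR o N) R = opR o (fin N R).
Proof.
elim: N G D U V => [vs|l N IH|o' N IH] G D U V //=.
case=> E [V' [b _ h]] k a; rewrite (wt_ctx h) (wt_ctx (wt_fin h k)).
case: ifP => m; last by rewrite /= (wt_ctx (wt_fin h k)) m.
have [D' b' a'] := swap_acts a b m.
by rewrite /= (IH _ _ _ _ h k a').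
Qed.

Lemma tsub_fin N R G U V U' W As Bs s : wt N G U As V -> wt R As U' Bs W ->
  tgt s = G -> tsub (fin N R) s = fin (tsub N s) R.
Proof.
elim: N G U V s => [vs|l N IH|o N IH] G U V s /=.
- by case=> -> _ e _ k hs; rewrite (tsub_tsub k).
- case=> D [V' [a _ h]] k hs; have [h1 _ _] := subL_spec a hs.
  by rewrite (IH _ _ _ _ h k h1).
case=> D [V' [a _ h]] k hs; have [h1 _ _] := subR_spec a hs.
by rewrite (tsub_opR a (wt_fin h k) hs) (wt_ctx h) (IH _ _ _ _ h k h1).
Qed.

Lemma wt_jall Ns G U As W : 0 < size Ns -> wts Ns G U As W -> wt (jall Ns) G U As W.
Proof. by case: Ns => // N Ns _; apply: wt_jfold. Qed.

End Traces.

Arguments Put {M} _.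
Arguments Get {M} _.
Arguments End {M} _.

Scheme has_type_mut := Minimality for has_type Sort Prop
  with has_types_mut := Minimality for has_types Sort Prop.
Combined Scheme has_type_mutind from has_type_mut, has_types_mut.

(** * Evaluation of terms to traces *)

Section Normalisation.

Variable M : multicategory.
Implicit Types (t q r : preterm M) (a b ts : seq (preterm M)).
Implicit Types (u v w : mor M) (vs ws s : seq (mor M)) (A B : obj M).
Implicit Types (G D E As Bs : seq (obj M)) (U V W : word M).

Fixpoint nf t : trace M :=
  match t with
  | Ret v => End [:: v]
  | Let ts r => fin (jall (map nf ts)) (nf r)
  | PutR v q => opR (Put v) (nf q)
  | GetL A q => OpL (Get A) (nf q)
  | GetR A q => opR (Get A) (nf q)
  | PutL v q => OpL (Put v) (nf q)
  end.

(** Names the anonymous local recursion of [vsubst], so that the mutual inductions below can speak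
    of it; [vsubst_Let] then holds by conversion. *)
Definition vsubsts :=
  fix vsubsts ts vs : seq (preterm M) :=
    match ts with
    | [::] => [::]
    | t1 :: ts1 =>
        vsubst t1 (take (size (ctx t1)) vs)
          :: vsubsts ts1 (drop (size (ctx t1)) vs)
    end.

Lemma vsubst_Let ts r s : vsubst (Let ts r) s = Let (vsubsts ts s) r.
Proof. by []. Qed.

Lemma wt_nf_both :
  (forall G t U B W, has_type G t U B W -> wt (nf t) G U [:: B] W) /\
  (forall G ts U As W, has_types G ts U As W -> wts (map nf ts) G U As W).
Proof.
apply: (@has_type_mutind M) => /=.
- by move=> v; rewrite /src /= cats0.
- move=> G ts U0 As Un t V B W n _ h _ k; apply: wt_fin k.
  by apply: wt_jall => //; rewrite size_map.
- by move=> v D t U B W _ h; apply: (wt_opR (o := Put v)) h.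
- by move=> A G t U B W _ h; exists (A :: G), U.
- by move=> A G t U B W _ h; apply: (wt_opR (o := Get A)) h.
- by move=> v D t U B W _ h; exists D, U.
- by [].
- by move=> G D t ts U A V As W _ h _ k; exists G, D, A, V, As.
Qed.

Definition wt_nf := wt_nf_both.1.
Definition wts_nf := wt_nf_both.2.

(** * Contexts, typing and evaluation under value substitution *)

Lemma ctx_both :
  (forall G t U B W, has_type G t U B W -> ctx t = G) /\
  (forall G ts U As W, has_types G ts U As W -> flatten (map (@ctx M) ts) = G).
Proof.
apply: (@has_type_mutind M) => //=.
- by move=> v D t U B W _ ->.
- by move=> A G t U B W _ ->.
- by move=> A G t U B W _ ->; rewrite take_rcons_pred.
- by move=> v D t U B W _ ->.
- by move=> G D t ts U A V As W _ -> _ ->.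
Qed.

Definition has_type_ctx := ctx_both.1.

Lemma has_type_vsubst_both :
  (forall G t U B W, has_type G t U B W -> forall s, tgt s = G ->
    has_type (src s) (vsubst t s) U B W) /\
  (forall G ts U As W, has_types G ts U As W -> forall s, tgt s = G ->
    has_types (src s) (vsubsts ts s) U As W).
Proof.
apply: (@has_type_mutind M).
- move=> v s h /=; rewrite -(cod_comp h) /src -(dom_comp h); exact: type_ret.
- move=> G ts U0 As Un t V B W n h IH k _ s hs; rewrite vsubst_Let.
  apply: type_let (IH _ hs) k.
  by case: ts n {h IH}.
- move=> v D t U B W h IH s /= /tgt_split [s1 [s2 [-> h1 h2]]].
  rewrite (has_type_ctx h) -(tgt_size h1) take_size_cat ?drop_size_cat // src_cat.
  by rewrite -(cod_comp h2) /(src s2) -(dom_comp h2); apply: type_putR (IH _ h1).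
- move=> A G t U B W h IH s hs /=; apply: type_getL.
  have := IH (idm A :: s); rewrite /= cod_idm hs /src /= dom_idm; exact.
- move=> A G t U B W h IH s hs /=; apply: type_getR.
  have := IH (rcons s (idm A)); rewrite tgt_rcons src_rcons cod_idm hs dom_idm cats1.
  exact.
- move=> v D t U B W h IH s /= /tgt_split [s1 [s2 [-> h1 h2]]].
  rewrite -(tgt_size h1) take_size_cat ?drop_size_cat // src_cat.
  by rewrite -(cod_comp h1) /(src s1) -(dom_comp h1); apply: type_putL (IH _ h2).
- by move=> U [] // _; apply: types_nil.
move=> G D t ts U A V As W h IH k IHs s /= /tgt_split [s1 [s2 [-> h1 h2]]].
rewrite (has_type_ctx h) -(tgt_size h1) take_size_cat ?drop_size_cat // src_cat.
exact: types_cons (IH _ h1) (IHs _ h2).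
Qed.

Definition has_type_vsubst := has_type_vsubst_both.1.

Fixpoint tsubs (Ns : seq (trace M)) s :=
  if Ns is N :: Ps then
    tsub N (take (size (tctx N)) s) :: tsubs Ps (drop (size (tctx N)) s)
  else [::].

Lemma jall_tsubs Ns G U As W s : 0 < size Ns -> wts Ns G U As W -> tgt s = G ->
  jall (tsubs Ns s) = tsub (jall Ns) s.
Proof.
case: Ns => // N Ns _; elim: Ns N G U As s => [|P Ns IH] N G U As s.
  move=> /= [G1 [G2 [A [V [As' [-> _ h [-> _ _]]]]]]]; rewrite cats0 (wt_ctx h) => hs.
  by rewrite -(tgt_size hs) take_size.
move=> [G1 [G2 [A [V [As' [-> _ h k]]]]]] /tgt_split [s1 [s2 [-> h1 h2]]].
have := IH _ _ _ _ _ k h2.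
rewrite [tsubs]lock [jall (N :: _)]/= (tsub_juxt h (wt_jfold k) h1 h2) => <-.
by rewrite -lock /= (wt_ctx h) -(tgt_size h1) take_size_cat ?drop_size_cat.
Qed.

Lemma nf_vsubst_both :
  (forall G t U B W, has_type G t U B W -> forall s, tgt s = G ->
    nf (vsubst t s) = tsub (nf t) s) /\
  (forall G ts U As W, has_types G ts U As W -> forall s, tgt s = G ->
    map nf (vsubsts ts s) = tsubs (map nf ts) s).
Proof.
apply: (@has_type_mutind M).
- by move=> v s h; rewrite /= -(tgt_size h) take_size.
- move=> G ts U0 As Un t V B W n h IH k _ s hs; rewrite vsubst_Let /= (IH _ hs).
  have h' := wts_nf h; have n' : 0 < size (map nf ts) by rewrite size_map.
  by rewrite (jall_tsubs n' h' hs) -(tsub_fin (wt_jall n' h') (wt_nf k) hs).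
- move=> v D t U B W h IH s hs /=; have [h1 _ _] := subR_spec (o := Put v) erefl hs.
  rewrite (tsub_opR (o := Put v) erefl (wt_nf h) hs) /= (has_type_ctx h).
  by rewrite -IH.
- move=> A G t U B W h IH s hs /=; rewrite IH //=.
  by rewrite cod_idm hs.
- move=> A G t U B W h IH s hs /=.
  rewrite (tsub_opR (o := Get A) erefl (wt_nf h) hs) /= IH //.
  by rewrite tgt_rcons cod_idm hs.
- move=> v D t U B W h IH s hs /=; have [h1 _ _] := subL_spec (o := Put v) erefl hs.
  by rewrite -IH.
- by move=> U [].
move=> G D t ts U A V As W h IH k IHs s /= /tgt_split [s1 [s2 [-> h1 h2]]].
rewrite (has_type_ctx h) (wt_ctx (wt_nf h)) -(tgt_size h1) take_size_cat // drop_size_cat //.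
by rewrite IH // IHs.
Qed.

Definition nf_vsubst := nf_vsubst_both.1.

(** * Inversion and concatenation of typing derivations *)

Lemma has_type_RetP G v U B W : has_type G (Ret v) U B W ->
  [/\ G = dom v, U = [::], B = cod v & W = [::]].
Proof. by move=> h; inversion h. Qed.

Lemma has_type_LetP G ts r U B W : has_type G (Let ts r) U B W ->
  exists U0 As Un V W', [/\ 0 < size ts, has_types G ts U0 As Un,
    has_type As r V B W', U = U0 ++ V & W = Un ++ W'].
Proof. by move=> h; inversion h; exists U0, As, Un, V, W0. Qed.

Lemma has_type_PutRP G v t U B W : has_type G (PutR v t) U B W ->
  exists D W', [/\ G = D ++ dom v, W = (cod v, White) :: W' & has_type D t U B W'].
Proof. by move=> h; inversion h; exists D, W0. Qed.

Lemma has_type_GetLP G A t U B W : has_type G (GetL A t) U B W ->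
  exists U', U = (A, White) :: U' /\ has_type (A :: G) t U' B W.
Proof. by move=> h; inversion h; exists U0. Qed.

Lemma has_type_GetRP G A t U B W : has_type G (GetR A t) U B W ->
  exists W', W = (A, Black) :: W' /\ has_type (rcons G A) t U B W'.
Proof. by move=> h; inversion h; exists W0. Qed.

Lemma has_type_PutLP G v t U B W : has_type G (PutL v t) U B W ->
  exists D U', [/\ G = dom v ++ D, U = (cod v, Black) :: U' & has_type D t U' B W].
Proof. by move=> h; inversion h; exists D, U0. Qed.

Lemma has_types_consP G t ts U As W : has_types G (t :: ts) U As W ->
  exists G1 G2 A V As', [/\ has_type G1 t U A V, has_types G2 ts V As' W,
    G = G1 ++ G2 & As = A :: As'].
Proof. by move=> h; inversion h; exists G0, D, A, V, As0. Qed.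

Lemma has_types_nilP G U As W : has_types (M := M) G [::] U As W ->
  [/\ G = [::], As = [::] & U = W].
Proof. by move=> h; inversion h. Qed.

Lemma has_types_catP G a b U As W : has_types G (a ++ b) U As W ->
  exists G1 G2 As1 As2 V, [/\ has_types G1 a U As1 V, has_types G2 b V As2 W,
    G = G1 ++ G2 & As = As1 ++ As2].
Proof.
elim: a G U As => [|t a IH] G U As /=.
  by move=> h; exists [::], G, [::], As, U; split=> //; apply: types_nil.
case/has_types_consP=> G1 [G2 [A [V [As' [h /IH]]]]].
case=> G3 [G4 [As3 [As4 [V' [k1 k2 -> ->]]]]] -> ->.
exists (G1 ++ G3), G4, (A :: As3), As4, V'; rewrite catA; split=> //.
exact: types_cons h k1.
Qed.

Lemma has_types_cat G D a b U V W As Bs : has_types G a U As V ->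
  has_types D b V Bs W -> has_types (G ++ D) (a ++ b) U (As ++ Bs) W.
Proof.
elim: a G U As => [|t a IH] G U As; first by case/has_types_nilP=> -> -> ->.
case/has_types_consP=> G1 [G2 [A [V' [As' [h k -> ->]]]]] kb.
by rewrite -catA; apply: types_cons h (IH _ _ _ k kb).
Qed.

Lemma has_types1 G t U A W : has_type G t U A W -> has_types G [:: t] U [:: A] W.
Proof. by move=> h; rewrite -[G]cats0; apply: types_cons h (types_nil _). Qed.

Lemma has_types_rconsP G a t U As W : has_types G (rcons a t) U As W ->
  exists G1 G2 As1 A V, [/\ has_types G1 a U As1 V, has_type G2 t V A W,
    G = G1 ++ G2 & As = rcons As1 A].
Proof.
rewrite -cats1 => /has_types_catP [G1 [G2 [As1 [As2 [V [h k -> ->]]]]]].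
move: k => /has_types_consP [G3 [G4 [A [V' [As' [k /has_types_nilP [-> -> <-]]]]]]] -> ->.
by exists G1, G3, As1, A, V; rewrite cats0 cats1.
Qed.

Lemma has_types_rcons G D a t U V W As A : has_types G a U As V ->
  has_type D t V A W -> has_types (G ++ D) (rcons a t) U (rcons As A) W.
Proof. by move=> h k; rewrite -!cats1; apply: has_types_cat h (has_types1 k). Qed.

Lemma has_types_Ret G vs U As W : has_types G (map Ret vs) U As W ->
  [/\ G = src vs, As = tgt vs & U = W].
Proof.
elim: vs G U As => [|v vs IH] G U As; first by case/has_types_nilP=> -> -> ->.
case/has_types_consP=> G1 [G2 [A [V [As' [/has_type_RetP [-> -> -> ->] /IH]]]]].
by case=> -> -> <- -> ->.
Qed.

Lemma has_types_Ret_nil G v vs U As W : has_types G (map Ret (v :: vs)) U As W ->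
  U = [::] /\ W = [::].
Proof.
case/has_types_consP=> G1 [G2 [A [V [As' [/has_type_RetP [_ -> _ ->] h _ _]]]]].
by case/has_types_Ret: h => _ _ <-.
Qed.

(** * Invariance of typing and of normal forms under rewriting *)

Lemma has_type_vsubst_first v A t G U B W : has_type (A :: G) t U B W ->
  cod v = A -> has_type (dom v ++ G) (vsubst_first v t) U B W.
Proof.
move=> h e; rewrite /vsubst_first (has_type_ctx h) /=.
have := has_type_vsubst (s := v :: map idm G) h.
by rewrite /src /= -/(src _) src_idm e tgt_idm; apply.
Qed.

Lemma has_type_vsubst_last v A t G U B W : has_type (rcons G A) t U B W ->
  cod v = A -> has_type (G ++ dom v) (vsubst_last v t) U B W.
Proof.
move=> h e; rewrite /vsubst_last (has_type_ctx h) take_rcons_pred.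
have := has_type_vsubst (s := rcons (map idm G) v) h.
by rewrite src_rcons src_idm tgt_rcons e tgt_idm; apply.
Qed.

Lemma nf_vsubst_first v A t G U B W : has_type (A :: G) t U B W ->
  cod v = A -> nf (vsubst_first v t) = tsub_first v (nf t).
Proof.
move=> h e; rewrite /vsubst_first /tsub_first (has_type_ctx h) (wt_ctx (wt_nf h)) /=.
by apply: nf_vsubst h _ _; rewrite /= e tgt_idm.
Qed.

Lemma nf_vsubst_last v A t G U B W : has_type (rcons G A) t U B W ->
  cod v = A -> nf (vsubst_last v t) = tsub_last v (nf t).
Proof.
move=> h e; rewrite /vsubst_last /tsub_last (has_type_ctx h) (wt_ctx (wt_nf h)).
rewrite take_rcons_pred; apply: nf_vsubst h _ _.
by rewrite tgt_rcons e tgt_idm.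
Qed.

Lemma has_type_step t t' : prestep t t' -> forall G U B W,
  has_type G t U B W -> has_type G t' U B W.
Proof.
elim=> {t t'}.
- move=> vs t G U B W /has_type_LetP [U0 [As [Un [V [W' [n h k -> ->]]]]]].
  (* For a list of values [has_types] only equates the two outer words; that the list is nonempty
     makes them both empty. *)
  case/has_types_Ret: (h) => -> eAs _; case: vs n h eAs => // v vs _.
  case/has_types_Ret_nil=> -> -> eAs; exact: (has_type_vsubst k (esym eAs)).
- move=> a b v A t s r G U B W /has_type_LetP [U0 [As [Un [V [W' [n h k -> ->]]]]]].
  apply: type_let k; first by move: n; rewrite !size_cat.
  case/has_types_catP: h => [G1 [G2 [As1 [As2 [V' [h0 h -> ->]]]]]] /=.
  case/has_types_consP: h => G3 [G4 [A1 [V1 [As' [h1 h -> ->]]]]].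
  case/has_types_consP: h => G5 [G6 [A2 [V2 [As'' [h2 h -> ->]]]]].
  case/has_type_PutRP: h1 => D [X [-> eV h1]].
  case/has_type_GetLP: h2 => Y []; rewrite eV => -[e eX] h2; subst Y.
  apply: has_types_cat h0 _; rewrite -catA [dom v ++ _]catA.
  exact: types_cons h1 (types_cons (has_type_vsubst_first h2 e) h).
- move=> a b v A t s r G U B W /has_type_LetP [U0 [As [Un [V [W' [n h k -> ->]]]]]].
  apply: type_let k; first by move: n; rewrite !size_cat.
  case/has_types_catP: h => [G1 [G2 [As1 [As2 [V' [h0 h -> ->]]]]]] /=.
  case/has_types_consP: h => G3 [G4 [A1 [V1 [As' [h1 h -> ->]]]]].
  case/has_types_consP: h => G5 [G6 [A2 [V2 [As'' [h2 h -> ->]]]]].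
  case/has_type_GetRP: h1 => X [eV h1].
  case/has_type_PutLP: h2 => D [Y [->]]; rewrite eV => -[e eX] h2; subst Y.
  apply: has_types_cat h0 _; rewrite -catA catA.
  exact: types_cons (has_type_vsubst_last h1 (esym e)) (types_cons h2 h).
- move=> a v t r G U B W /has_type_LetP [U0 [As [Un [V [W' [n h k -> ->]]]]]].
  case/has_types_consP: h k => G1 [G2 [A [V1 [As' [h1 h -> ->]]]]] k.
  case/has_type_PutLP: h1 => D [Y [-> -> h1]]; rewrite -catA.
  by apply: type_putL; apply: type_let k => //; apply: types_cons h1 h.
- move=> a A t r G U B W /has_type_LetP [U0 [As [Un [V [W' [n h k -> ->]]]]]].
  case/has_types_consP: h k => G1 [G2 [A1 [V1 [As' [h1 h -> ->]]]]] k.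
  case/has_type_GetLP: h1 => Y [-> h1].
  by apply: type_getL; apply: type_let k => //; apply: (types_cons h1 h).
- move=> a v t r G U B W /has_type_LetP [U0 [As [Un [V [W' [n h k -> ->]]]]]].
  case/has_types_rconsP: h k => G1 [G2 [As1 [A [V' [h1 h2 -> ->]]]]] k.
  case/has_type_PutRP: h2 => D [X [-> -> h2]]; rewrite catA.
  apply: type_putR; apply: type_let k; first by rewrite size_rcons.
  exact: has_types_rcons h1 h2.
- move=> a A t r G U B W /has_type_LetP [U0 [As [Un [V [W' [n h k -> ->]]]]]].
  case/has_types_rconsP: h k => G1 [G2 [As1 [A' [V' [h1 h2 -> ->]]]]] k.
  case/has_type_GetRP: h2 => X [-> h2].
  apply: type_getR; apply: type_let k; first by rewrite size_rcons.
  by rewrite rcons_cat; apply: has_types_rcons h1 h2.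
- move=> v w t G U B W /has_type_PutRP [D [X [-> ->]]].
  case/has_type_PutLP=> E [Y [-> -> h]]; rewrite -catA.
  by apply: type_putL; apply: type_putR.
- move=> v A t G U B W /has_type_PutRP [D [X [-> ->]]].
  case/has_type_GetLP=> Y [-> h].
  by apply: type_getL; apply: (type_putR v h).
- move=> v A t n G U B W /has_type_GetRP [X [->]].
  case/has_type_PutLP=> E [Y [e -> h]].
  (* The side condition of [R9] makes the bound variable the last one of [ctx t], outside the source
     of [v]. *)
  rewrite (has_type_ctx h) in n; move: n e h; case/lastP: E => // E C _.
  rewrite -rcons_cat => /rcons_inj [-> ->] h.
  by apply: type_putL; apply: type_getR.
- move=> A C t G U B W /has_type_GetRP [X [->]].
  case/has_type_GetLP=> Y [-> h].
  by apply: type_getL; apply: type_getR.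
- move=> a b t t' r _ IH G U B W /has_type_LetP [U0 [As [Un [V [W' [n h k -> ->]]]]]].
  apply: type_let k; first by move: n; rewrite !size_cat.
  case/has_types_catP: h => [G1 [G2 [As1 [As2 [V' [h0 h -> ->]]]]]] /=.
  case/has_types_consP: h => G3 [G4 [A1 [V1 [As' [h1 h -> ->]]]]].
  exact: has_types_cat h0 (types_cons (IH _ _ _ _ h1) h).
- move=> ts r r' _ IH G U B W /has_type_LetP [U0 [As [Un [V [W' [n h /IH k -> ->]]]]]].
  exact: type_let k.
- by move=> v t t' _ IH G U B W /has_type_PutRP [D [X [-> -> /IH h]]]; apply: type_putR.
- by move=> A t t' _ IH G U B W /has_type_GetLP [X [-> /IH h]]; apply: type_getL.
- by move=> A t t' _ IH G U B W /has_type_GetRP [X [-> /IH h]]; apply: type_getR.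
by move=> v t t' _ IH G U B W /has_type_PutLP [D [X [-> -> /IH h]]]; apply: type_putL.
Qed.

(** The rules match the evaluation: [R0] is the [End] clause of [fin], [R1] and [R2] are
    cancellations, [R3] and [R4] are [jfoldL], [R5] and [R6] are [jall_opR] followed by [fin_opR],
    and [R7] to [R10] unfold [opR] once. *)
Lemma nf_step t t' : prestep t t' -> forall G U B W,
  has_type G t U B W -> nf t = nf t'.
Proof.
elim=> {t t'}.
- move=> vs t G U B W /has_type_LetP [U0 [As [Un [V [W' [n h k _ _]]]]]].
  case/has_types_Ret: h => _ eAs _; rewrite (nf_vsubst k) //=.
  (* Juxtaposing [End] traces concatenates their values. *)
  suff -> : jall (map nf (map Ret vs)) = End vs by [].
  case: vs n {eAs} => // v vs _ /=; elim: vs v => //= w vs IH v.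
  by rewrite IH.
- move=> a b v A t s r G U B W /has_type_LetP [U0 [As [Un [V [W' [n h k _ _]]]]]].
  case/has_types_catP: h => [G1 [G2 [As1 [As2 [V' [_ h _ _]]]]]] /=.
  case/has_types_consP: h => G3 [G4 [A1 [V1 [As' [h1 h _ _]]]]].
  case/has_types_consP: h => G5 [G6 [A2 [V2 [As'' [h2 h _ _]]]]].
  case/has_type_PutRP: h1 => D [X [_ eV h1]].
  case/has_type_GetLP: h2 => Y []; rewrite eV => -[e eX] h2; subst Y.
  congr fin; rewrite !map_cat; apply: jall_cat.
  rewrite /= (nf_vsubst_first h2 e).
  exact: jfold_putget (wt_nf h1) (wt_nf h2) (wts_nf h) e.
- move=> a b v A t s r G U B W /has_type_LetP [U0 [As [Un [V [W' [n h k _ _]]]]]].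
  case/has_types_catP: h => [G1 [G2 [As1 [As2 [V' [_ h _ _]]]]]] /=.
  case/has_types_consP: h => G3 [G4 [A1 [V1 [As' [h1 h _ _]]]]].
  case/has_types_consP: h => G5 [G6 [A2 [V2 [As'' [h2 h _ _]]]]].
  case/has_type_GetRP: h1 => X [eV h1].
  case/has_type_PutLP: h2 => D [Y [_]]; rewrite eV => -[e eX] h2; subst Y.
  congr fin; rewrite !map_cat; apply: jall_cat.
  rewrite /= (nf_vsubst_last h1 (esym e)).
  exact: jfold_getput (wt_nf h1) (wts_nf (types_cons h2 h)) (esym e).
- by move=> a v t r G U B W _ /=; rewrite jfoldL.
- by move=> a A t r G U B W _ /=; rewrite jfoldL.
- move=> a v t r G U B W /has_type_LetP [U0 [As [Un [V [W' [n h k _ _]]]]]].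
  case/has_types_rconsP: h => G1 [G2 [As1 [A [V' [h1 h2 _ eAs]]]]].
  case/has_type_PutRP: h2 => D [X [_ eV h2]].
  rewrite /= !map_rcons.
  have [-> h'] := jall_opR (o := Put v) (wts_nf h1) (wt_nf h2) erefl.
  move: (wt_nf k); rewrite eAs -cats1 => k'.
  have a' : actR (Put v) (D ++ dom v) D by [].
  exact: (fin_opR h' k' (actR_cat G1 a')).
- move=> a A t r G U B W /has_type_LetP [U0 [As [Un [V [W' [n h k _ _]]]]]].
  case/has_types_rconsP: h => G1 [G2 [As1 [A' [V' [h1 h2 _ eAs]]]]].
  case/has_type_GetRP: h2 => X [eV h2].
  rewrite /= !map_rcons.
  have [-> h'] := jall_opR (o := Get A) (wts_nf h1) (wt_nf h2) erefl.
  move: (wt_nf k); rewrite eAs -cats1 => k'.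
  have a' : actR (Get A) G2 (rcons G2 A) by [].
  exact: (fin_opR h' k' (actR_cat G1 a')).
(* For [R7], [R8] and [R10] the test [movable] computes to true. *)
- by [].
- by [].
- move=> v A t n G U B W /has_type_GetRP [X [eV]].
  case/has_type_PutLP=> D [Y [_ _ h]] /=.
  by rewrite (wt_ctx (wt_nf h)) -(has_type_ctx h) n.
- by [].
- move=> a b t t' r _ IH G U B W /has_type_LetP [U0 [As [Un [V [W' [n h k _ _]]]]]].
  case/has_types_catP: h => [G1 [G2 [As1 [As2 [V' [_ h _ _]]]]]] /=.
  case/has_types_consP: h => G3 [G4 [A1 [V1 [As' [h1 h _ _]]]]].
  by rewrite !map_cat /= (IH _ _ _ _ h1).
- by move=> ts r r' _ IH G U B W /has_type_LetP [U0 [As [Un [V [W' [_ _ /IH /= -> _ _]]]]]].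
- by move=> v t t' _ IH G U B W /has_type_PutRP [D [X [_ _ /IH /= ->]]].
- by move=> A t t' _ IH G U B W /has_type_GetLP [X [_ /IH /= ->]].
- by move=> A t t' _ IH G U B W /has_type_GetRP [X [_ /IH /= ->]].
by move=> v t t' _ IH G U B W /has_type_PutLP [D [X [_ _ /IH /= ->]]].
Qed.

(** * Reduction of a term to its normal form *)

Definition psteps : preterm M -> preterm M -> Prop :=
  clos_refl_trans (preterm M) (@prestep M).

Lemma psteps_trans t q r : psteps t q -> psteps q r -> psteps t r.
Proof. exact: rt_trans. Qed.

Lemma psteps_step t q r : prestep t q -> psteps q r -> psteps t r.
Proof. by move=> h; apply: rt_trans; apply: rt_step. Qed.

Lemma psteps_congr (f : preterm M -> preterm M) t t' :
    (forall q q', prestep q q' -> prestep (f q) (f q')) ->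
  psteps t t' -> psteps (f t) (f t').
Proof.
move=> hf; elim=> {t t'} [t t' h|t|t q r _ h _ k]; [exact/rt_step/hf|exact: rt_refl|].
exact: rt_trans h k.
Qed.

Lemma has_type_steps t t' G U B W : psteps t t' -> has_type G t U B W ->
  has_type G t' U B W.
Proof. by elim=> {t t'} [t t' /has_type_step h /h|//|t q r _ h _ k /h /k]. Qed.

Lemma nf_steps t t' G U B W : psteps t t' -> has_type G t U B W -> nf t = nf t'.
Proof.
elim=> {t t'} [t t' /nf_step h /h|//|t q r h IH _ IH' k] //.
by rewrite IH // IH' //; apply: has_type_steps h k.
Qed.

(** Reads a trace back as a let-free term. A trace with target [[:: B]] ends with exactly one value,
    so for those the default [v0] is never returned. *)
Fixpoint emb v0 (N : trace M) : preterm M :=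
  match N with
  | End vs => Ret (head v0 vs)
  | OpL (Put v) P => PutL v (emb v0 P)
  | OpL (Get A) P => GetL A (emb v0 P)
  | OpR (Put v) P => PutR v (emb v0 P)
  | OpR (Get A) P => GetR A (emb v0 P)
  end.

Lemma ctx_emb v0 N G U B W : wt N G U [:: B] W -> ctx (emb v0 N) = G.
Proof.
elim: N G U W => [vs|o N IH|o N IH] G U W /=.
- by case: vs => [|v [|w vs]] [-> _ e _] //; rewrite /src /= cats0.
- by case=> D [U' [a _ /IH e]]; case: o a => [v|A] /=; rewrite e => ->.
by case=> D [U' [a _ /IH e]]; case: o a => [v|A] /=; rewrite e => ->; rewrite ?take_rcons_pred.
Qed.

Lemma vsubst_emb v0 N G U B W s : wt N G U [:: B] W -> tgt s = G ->
  vsubst (emb v0 N) s = emb v0 (tsub N s).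
Proof.
elim: N G U W s => [vs|o N IH|o N IH] G U W s /=.
- case: vs => [|v [|w vs]] [-> _ e _] //; rewrite /src /= cats0 => hs.
  by rewrite -(tgt_size hs) take_size.
- case=> D [U' [a _ h]] hs; have [h1 _ _] := subL_spec a hs.
  by have := IH _ _ _ _ h h1; case: o {a h1} => [v|A] /= ->.
case=> D [U' [a _ h]] hs; have [h1 _ _] := subR_spec a hs.
rewrite (wt_ctx h).
have := IH _ _ _ _ h h1; case: o {a h1} => [v|A] /= <- //.
by rewrite (ctx_emb v0 h).
Qed.

(** Each left operation passed by [opR] is one step [R7], [R8], [R9] or [R10], according to the
    kinds of [o] and [l]. *)
Lemma emb_opR v0 o N G D U B W : actR o G D -> wt N D U [:: B] W ->
  psteps (emb v0 (OpR o N)) (emb v0 (opR o N)).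
Proof.
elim: N G D U => [vs|l N IH|o' N IH] G D U a; try by move=> *; apply: rt_refl.
case=> E [U' [b _ h]] /=; rewrite (wt_ctx h); case: ifP => m; last exact: rt_refl.
have [D' b' a'] := swap_acts a b m.
have {IH} := IH _ _ _ a' h.
case: o l {a b a' b'} m => [v|A] [w|C] /= m k.
- by apply: psteps_step (R7 _ _ _) _; apply: psteps_congr k => *; apply: step_putL.
- by apply: psteps_step (R8 _ _ _) _; apply: psteps_congr k => *; apply: step_getL.
- apply: psteps_step (R9 _ _ _) _; first by rewrite (ctx_emb v0 h).
  by apply: psteps_congr k => *; apply: step_putL.
by apply: psteps_step (R10 _ _ _) _; apply: psteps_congr k => *; apply: step_getL.
Qed.

(** * Reduction of a let whose arguments are let-free *)

Fixpoint letfree t :=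
  match t with
  | Ret _ => true
  | Let _ _ => false
  | PutR _ q | GetL _ q | GetR _ q | PutL _ q => letfree q
  end.

(** Counts the operations above the final value of a let-free term. Summed over the arguments of a
    let, it decreases under [R1] to [R6], since substitution preserves it. *)
Fixpoint psize t :=
  match t with
  | PutR _ q | GetL _ q | GetR _ q | PutL _ q => (psize q).+1
  | _ => 0
  end.

Lemma letfree_vsubst t s : letfree (vsubst t s) = letfree t.
Proof. by elim: t s => //= *. Qed.

Lemma psize_vsubst t s : psize (vsubst t s) = psize t.
Proof. by elim: t s => //= [v t IH|A t IH|A t IH|v t IH] s; rewrite IH. Qed.

Lemma letfree_emb v0 N : letfree (emb v0 N).
Proof. by elim: N => [vs|[v|A] N|[v|A] N]. Qed.

Definition lefthead t :=
  match t with GetL _ _ | PutL _ _ => true | _ => false end.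

Definition righthead t :=
  match t with GetR _ _ | PutR _ _ => true | _ => false end.

(** Some rule among [R0], [R1], [R2], [R5] and [R6] applies to the arguments of a let,
    unless [R3] or [R4] does. *)
Lemma args_progress t ts G U As W : has_types G (t :: ts) U As W ->
    all letfree (t :: ts) -> ~~ lefthead t ->
  [\/ exists vs, t :: ts = map Ret vs,
      exists a q, t :: ts = rcons a q /\ righthead q
    | exists a q q' b, [/\ t :: ts = a ++ [:: q, q' & b], righthead q & lefthead q']].
Proof.
elim: ts t G U As => [|q ts IH] t G U As.
  case: t => // [v|v t|A t] _ _ _; [constructor 1; by exists [:: v]|constructor 2|constructor 2].
    by exists [::], (PutR v t).
  by exists [::], (GetR A t).
case/has_types_consP=> G1 [G2 [A [V [As' [h1 h _ _]]]]].
rewrite [all _ _]/= => /andP [f fs] l.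
case lq: (lefthead q).
  case: t f l h1 => // [v|v t|C t] f l h1; last 2 first.
  - by constructor 3; exists [::], (PutR v t), q, ts.
  - by constructor 3; exists [::], (GetR C t), q, ts.
  (* A value [t] has an empty right word, whereas the left word of the left-headed [q] is
     nonempty. *)
  case/has_type_RetP: h1 => _ _ _ eV; subst V.
  case/has_types_consP: h => G3 [G4 [A3 [V3 [As3 [h _ _ _]]]]].
  case: q lq h {fs IH} => // [C q|v' q] _.
    by case/has_type_GetLP=> ? [].
  by case/has_type_PutLP=> ? [? []].
case: (IH _ _ _ _ h fs (negbT lq)) => [[[|w vs] //= e]|[a [r [e hr]]]|[a [r [r' [b [e hr hl]]]]]].
- case: t f l h1 => // [v|v t|C t] f l h1.
  + by constructor 1; exists (v :: w :: vs); rewrite e.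
  (* All later arguments are values, so the word to the right of [t] is empty and [t] cannot be
     right-headed. *)
  + case/has_type_PutRP: h1 => ? [? [_ eV]].
    by case: e h => -> ->; rewrite eV -[_ :: _]/(map Ret (w :: vs)) => /has_types_Ret_nil [].
  case/has_type_GetRP: h1 => ? [eV].
  by case: e h => -> ->; rewrite eV -[_ :: _]/(map Ret (w :: vs)) => /has_types_Ret_nil [].
- by constructor 2; exists (t :: a), r; rewrite e.
by constructor 3; exists (t :: a), r, r', b; rewrite e.
Qed.

(** Induction on a bound [n] for the number of operations left in the arguments: a leading left
    operation is emitted by [R3] or [R4], and otherwise [args_progress] provides a rule. *)
Lemma Let_letfree v0 n ts r G U B W : sumn (map psize ts) < n -> all letfree ts ->
    has_type G (Let ts r) U B W -> psteps r (emb v0 (nf r)) ->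
  psteps (Let ts r) (emb v0 (nf (Let ts r))).
Proof.
elim: n ts G U W => // n IH [|t ts] G U W; first by move=> _ _ /has_type_LetP [? [? [? [? [? []]]]]].
move=> hn f h k.
(* As [nf] is invariant, it suffices to reach the normal form from any one-step reduct. *)
have step_in q : prestep (Let (t :: ts) r) q -> psteps q (emb v0 (nf q)) ->
    psteps (Let (t :: ts) r) (emb v0 (nf (Let (t :: ts) r))).
  by move=> s p; rewrite (nf_step s h); apply: psteps_step s p.
case lt: (lefthead t).
  move: hn f h; case: t lt step_in => // [A t|v t] _ step_in /= hn f h.
    have s := R4 ts A t r; apply: (step_in _ s).
    case/has_type_GetLP: (has_type_step s h) => U' [_ h'].
    have {}IH := IH (t :: ts) _ _ _ hn f h' k.
    by apply: (psteps_congr (f := GetL A)) IH => *; apply: step_getL.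
  have s := R3 ts v t r; apply: (step_in _ s).
  case/has_type_PutLP: (has_type_step s h) => D [U' [_ _ h']].
  have {}IH := IH (t :: ts) _ _ _ hn f h' k.
  by apply: (psteps_congr (f := PutL v)) IH => *; apply: step_putL.
case/has_type_LetP: (h) => U0 [As [Un [V [W' [_ hts hr _ _]]]]].
case: (args_progress hts f (negbT lt)) => [[vs e]|[a [q [e hq]]]|[a [q [q' [b [e hq hq']]]]]];
  rewrite {}e in hn f h hts step_in *.
(* The body is normalised before [R0] is applied, so that no stability of rewriting under value
   substitution has to be shown. *)
- have p : psteps (Let (map Ret vs) r) (Let (map Ret vs) (emb v0 (nf r))).
    by apply: psteps_congr k => *; apply: step_let_body.
  apply: psteps_trans p (psteps_step (R0 _ _) _).
  have [_ eAs _] := has_types_Ret hts.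
  rewrite (vsubst_emb v0 (wt_nf hr) (esym eAs)).
  by rewrite (nf_step (R0 vs r) h) (nf_vsubst hr (esym eAs)); apply: rt_refl.
- move: hn f h; rewrite map_rcons sumn_rcons all_rcons.
  case: q hq step_in {hts} => // [v q|A q] _ step_in /= hn f h.
    have s := R5 a v q r; apply: (step_in _ s).
    case/has_type_PutRP: (has_type_step s h) => D [X [_ _ h']].
    have {}IH : psteps (Let (rcons a q) r) (emb v0 (nf (Let (rcons a q) r))).
      apply: IH h' k; last by rewrite all_rcons.
      by rewrite map_rcons sumn_rcons; move: hn; rewrite addnS ltnS.
    (* The emitted putR now sits above a normal form that may begin with left operations, and is
       moved below them. *)
    apply: psteps_trans (emb_opR v0 (o := Put v) erefl (wt_nf h')).
    by apply: (psteps_congr (f := PutR v)) IH => *; apply: step_putR.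
  have s := R6 a A q r; apply: (step_in _ s).
  case/has_type_GetRP: (has_type_step s h) => X [_ h'].
  have {}IH : psteps (Let (rcons a q) r) (emb v0 (nf (Let (rcons a q) r))).
    apply: IH h' k; last by rewrite all_rcons.
    by rewrite map_rcons sumn_rcons; move: hn; rewrite addnS ltnS.
  apply: psteps_trans (emb_opR v0 (o := Get A) erefl (wt_nf h')).
  by apply: (psteps_congr (f := GetR A)) IH => *; apply: step_getR.
case/has_types_catP: hts => [G1 [G2 [As1 [As2 [V' [_ h0 _ _]]]]]].
case/has_types_consP: h0 => G3 [G4 [A1 [V1 [As' [h1 h0 _ _]]]]].
case/has_types_consP: h0 => G5 [G6 [A2 [V2 [As'' [h2 _ _ _]]]]].
move: hn f; rewrite map_cat sumn_cat all_cat.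
case: q hq step_in h h1 => // [v q|A q] _ step_in h.
  case/has_type_PutRP=> D [X [_ eV _]].
  (* A putR cannot face a putL: the letters they give to the shared boundary have opposite
     polarities. *)
  case: q' hq' step_in h h2 => // [C q'|w q'] _ step_in h; last first.
    by case/has_type_PutLP=> ? [? [_]]; rewrite eV.
  move=> _ /= hn f; have s := R1 a b v C q q' r.
  apply: (step_in _ s); apply: IH (has_type_step s h) k.
    rewrite map_cat sumn_cat /= psize_vsubst; move: hn; lia.
  by rewrite all_cat /= letfree_vsubst.
case/has_type_GetRP=> X [eV _].
case: q' hq' step_in h h2 => // [C q'|w q'] _ step_in h.
  by case/has_type_GetLP=> ? []; rewrite eV.
move=> _ /= hn f; have s := R2 a b w A q q' r.
apply: (step_in _ s); apply: IH (has_type_step s h) k.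
  rewrite map_cat sumn_cat /= psize_vsubst; move: hn; lia.
by rewrite all_cat /= letfree_vsubst.
Qed.

(** For a let, the arguments are normalised first, which makes them let-free, and [Let_letfree]
    applies. In the second conjunct [a] collects the arguments already treated. *)
Lemma psteps_emb_both v0 :
  (forall G t U B W, has_type G t U B W -> psteps t (emb v0 (nf t))) /\
  (forall G ts U As W, has_types G ts U As W -> forall a r,
    psteps (Let (a ++ ts) r) (Let (a ++ map (emb v0 \o @nf) ts) r)).
Proof.
apply: (@has_type_mutind M) => /=.
- by move=> v; apply: rt_refl.
- move=> G ts U0 As Un t V B W n h IH k IHt.
  have h' := type_let n h k; have s := IH [::] t.
  rewrite [fin _ _](nf_steps s h').
  apply: (psteps_trans s); apply: Let_letfree (ltnSn _) _ (has_type_steps s h') IHt.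
  by elim: (ts) => //= q ts' ->; rewrite letfree_emb.
- move=> v D t U B W h IH.
  apply: psteps_trans (emb_opR v0 (o := Put v) erefl (wt_nf h)).
  by apply: (psteps_congr (f := PutR v)) IH => *; apply: step_putR.
- by move=> A G t U B W h IH; apply: (psteps_congr (f := GetL A)) IH => *; apply: step_getL.
- move=> A G t U B W h IH.
  apply: psteps_trans (emb_opR v0 (o := Get A) erefl (wt_nf h)).
  by apply: (psteps_congr (f := GetR A)) IH => *; apply: step_getR.
- by move=> v D t U B W h IH; apply: (psteps_congr (f := PutL v)) IH => *; apply: step_putL.
- by move=> *; apply: rt_refl.
move=> G D t ts U A V As W _ IH _ IHs a r.
apply: psteps_trans (_ : psteps _ (Let (a ++ emb v0 (nf t) :: ts) r)) _.
  by apply: (psteps_congr (f := fun q => Let (a ++ q :: ts) r)) IH => *; apply: step_let_arg.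
by rewrite -!cat_rcons; apply: IHs.
Qed.

(** Supplies the default of [emb]: a multicategory may have no morphism at all, but every preterm
    contains one. *)
Fixpoint some_mor t : mor M :=
  match t with
  | Ret v => v
  | Let _ q | PutR _ q | GetL _ q | GetR _ q | PutL _ q => some_mor q
  end.

(** * Transfer of rewriting between preterms and terms *)

Lemma steps_of_psteps (t : term M) q : psteps (sval t) q ->
  exists2 t' : term M, sval t' = q & steps t t'.
Proof.
(* The path is extended at its end, so that each new preterm gets its type from the term already
   built. *)
case: t => t ht /=; move=> /clos_rt_rtn1_iff; elim=> {q} [|q q' s _ [[p hp] /= e k]].
  by exists (exist _ t ht) => //; apply: rt_refl.
subst p; have hq' : exists G U B W, has_type G q' U B W.
  by case: hp {k} => [G [U [B [W h]]]]; exists G, U, B, W; apply: has_type_step s _ _ _ _ h.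
exists (exist _ q' hq') => //.
by apply: rt_trans k _; apply: rt_step.
Qed.

Lemma psteps_of_steps (t t' : term M) : steps t t' -> psteps (sval t) (sval t').
Proof.
elim=> {t t'} [t t' h|t|t q r _ h _ k]; [exact: rt_step|exact: rt_refl|].
exact: rt_trans h k.
Qed.

(** A term contains a proof that it has a type, hence the appeal to proof
    irrelevance. *)
Lemma term_inj (t t' : term M) : sval t = sval t' -> t = t'.
Proof.
by case: t t' => [t h] [t' h'] /= e; subst t'; rewrite (proof_irrelevance _ h h').
Qed.

End Normalisation.

Theorem theorem3p18 (M : multicategory) (t t1 t2 : term M) :
  steps t t1 -> steps t t2 -> exists h : term M, steps t1 h /\ steps t2 h.
Proof.
move=> /psteps_of_steps s1 /psteps_of_steps s2.
have [G [U [B [W ht]]]] := svalP t.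
have [e1 e2] := (nf_steps s1 ht, nf_steps s2 ht).
have v0 := some_mor (sval t).
have p1 := (psteps_emb_both v0).1 _ _ _ _ _ (has_type_steps s1 ht).
have p2 := (psteps_emb_both v0).1 _ _ _ _ _ (has_type_steps s2 ht).
have [h1 k1 q1] := steps_of_psteps p1.
have [h2 k2 q2] := steps_of_psteps p2.
(* Both [h1] and [h2] lie over the embedding of the normal form of [t]; they may differ only in
   their typing proofs. *)
exists h1; split=> //; suff -> : h1 = h2 by [].
by apply: term_inj; rewrite k1 k2 -e1 -e2.
Qed.
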